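(* Consider the hybrid extremum seeking system $\mathcal{H}_\varepsilon$ on the manifold $M$ defined in the context, with frequencies $w_1,\dots,w_r\in\mathbb{Q}_{>0}$ satisfying $w_i\ne w_j$ for $i\neq j$. Suppose that: (1) $M\subset\mathbb{R}^n$ is a smooth, embedded, connected, compact submanifold without boundary, endowed with the Riemannian metric induced by the canonical inner product of $\mathbb{R}^n$; (2) $J$ is smooth on an open set $U\subset\mathbb{R}^n$ containing $M$, has a unique minimizer $x^\star\in M$ on $M$, i.e. $J(x^\star)<J(x)$ for all $x\in M$, $x\neq x^\star$, and there is a (known) number $\bar J\in(0,\infty)$ such that for all $x\in M$ with $J(x)<J(x^\star)+\bar J$ one has $\nabla_MJ(x)=0\iff x=x^\star$; (3) $\{b_1,\dots,b_r\}$ is a family of smooth vector fields on $M$ such that, for $P(x)[v]=\sum_{i=1}^r\langle b_i(x),v\rangle b_i(x)$, $x\in M$, $v\in\mathbb{R}^n$, one has $P(x)[v]=0\iff v\in(T_xM)^\perp$; (4) $\{\tilde J_q\}_{q\in\mathcal{Q}}$ is a $\delta$-gap synergistic family of functions subordinate to $J$ on $M$. Then the set $\mathcal{A}=\{x^\star\}\times\mathcal{Q}$ is globally practically asymptotically stable (GPAS) as $\varepsilon\to0^+$ for $\mathcal{H}_\varepsilon$.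
   Context: **Hybrid systems.** A hybrid dynamical system (HDS) with data $(C,F,D,G)$ is written $y\in C,\ \dot y\in F(y)$; $y\in D,\ y^+\in G(y)$, with $F,G$ set-valued. A compact hybrid time domain is a set $E=\bigcup_{j=0}^{J-1}([t_j,t_{j+1}],j)\subset\mathbb{R}_{\ge0}\times\mathbb{Z}_{\ge0}$ for a finite sequence $0=t_0\le t_1\le\dots\le t_J$; $E$ is a hybrid time domain if $E\cap([0,T]\times\{0,\dots,J\})$ is a compact hybrid time domain for all $(T,J)\in E$. A solution is a function $y$ on a hybrid time domain $\mathrm{dom}(y)$, with $y(\cdot,j)$ locally absolutely continuous for each $j$ for which $I_j=\{t:(t,j)\in\mathrm{dom}(y)\}$ has nonempty interior, such that $y(0,0)\in C\cup D$; for each such $j$, $y(t,j)\in C$ for all $t\in I_j$ and $\dot y(t,j)\in F(y(t,j))$ for almost all $t\in I_j$; and whenever $(t,j),(t,j+1)\in\mathrm{dom}(y)$, $y(t,j)\in D$ and $y(t,j+1)\in G(y(t,j))$. **Notation and synergistic families.** $\nabla_Mf(x)$ denotes the orthogonal projection of the Euclidean gradient $\nabla f(x)$ onto $T_xM$. Let $\mathcal{Q}=\{1,\dots,N\}$. A family $\{\tilde J_q\}_{q\in\mathcal{Q}}$ is a $\delta$-gap synergistic family of functions subordinate to $J$ on $M$ if: (i) for all $q\in\mathcal{Q}$, $\tilde J_q:U\to\mathbb{R}$ is smooth, its unique minimizer on $M$ is $x^\star$, and it has a finite set of critical points $\mathrm{Crit}\,\tilde J_q=\{x\in M:\nabla_M\tilde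 J_q(x)=0\}$; (ii) for all $q\in\mathcal{Q}$ and $x\in M$, $J(x)<\bar J+J(x^\star)$ implies $\tilde J_q(x)=J(x)$; (iii) $\delta\in(0,\infty)$ satisfies $$\delta<\Delta^*:=\min_{q_1\in\mathcal{Q},\ x\in\mathrm{Crit}\,\tilde J_{q_1}\setminus\{x^\star\}}\ \max_{q_2\in\mathcal{Q}}\big(\tilde J_{q_1}(x)-\tilde J_{q_2}(x)\big).$$ **The hybrid system $\mathcal{H}_\varepsilon$.** Let $\kappa>0$, $\varepsilon>0$. The state is $(x,z,\tau)$ with $x\in M$, $z\in\mathcal{Q}$, $\tau=(\tau_1,\tau_2)\in\mathbb{R}^2_{\ge0}$. With $$C=\{(x,z)\in M\times\mathcal{Q}:\tilde J_z(x)-\min_{\tilde z\in\mathcal{Q}}\tilde J_{\tilde z}(x)\le\delta\},\quad D=\{(x,z)\in M\times\mathcal{Q}:\tilde J_z(x)-\min_{\tilde z\in\mathcal{Q}}\tilde J_{\tilde z}(x)\ge\delta\},$$ the flow for $(x,z)\in C$, $\tau\in\mathbb{R}^2_{\ge0}$ is $$\dot x=\sum_{i=1}^rb_i(x)\,\varepsilon^{-1}\sqrt{2w_i}\cos\big(\kappa\tilde J_z(x)+w_i\tau_2\big)\kappa^{-1/2},\quad\dot z=0,\quad\dot\tau_1=\varepsilon^{-1},\quad\dot\tau_2=\varepsilon^{-2},$$ and the jump for $(x,z)\in D$, $\tau\in\mathbb{R}^2_{\ge0}$ is $x^+=x$, $z^+\in\{q\in\mathcal{Q}:\tilde J_q(x)=\min_{\tilde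 z\in\mathcal{Q}}\tilde J_{\tilde z}(x)\}$, $\tau^+=\tau$. Write $\theta=(x,z)$. **Stability notions.** $|y|_{\mathcal{A}}=\min_{a\in\mathcal{A}}\|y-a\|_2$. $\beta:\mathbb{R}_{\ge0}\times\mathbb{R}_{\ge0}\to\mathbb{R}_{\ge0}$ is of class $\mathcal{KL}$ if it is nondecreasing in its first argument, nonincreasing in its second, $\lim_{r\to0^+}\beta(r,s)=0$ for each $s$ and $\lim_{s\to\infty}\beta(r,s)=0$ for each $r$. $\mathcal{A}$ is GPAS as $\varepsilon\to0^+$ for $\mathcal{H}_\varepsilon$ (note that $C\cup D=M\times\mathcal{Q}$ is compact) if there is $\beta\in\mathcal{KL}$ such that for each $\nu>0$ there is $\varepsilon^*>0$ such that for all $\varepsilon\in(0,\varepsilon^*]$ every solution satisfies $|\theta(t,j)|_{\mathcal{A}}\le\beta(|\theta(0,0)|_{\mathcal{A}},t+j)+\nu$ for all $(t,j)$ in its domain. *)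

(* Defs.v *)
(* MathComp-Analysis, over an arbitrary [R : realType]; R^n is ['rV[R]_n]. *)
From HB Require Import structures.
From mathcomp Require Import all_boot all_order all_algebra.
From mathcomp Require Import all_classical all_reals all_analysis.

Set Implicit Arguments.
Unset Strict Implicit.
Unset Printing Implicit Defensive.

Import Order.TTheory GRing.Theory Num.Theory.
Import numFieldNormedType.Exports.

Local Open Scope classical_set_scope.
Local Open Scope ring_scope.

Section EuclideanSpace.
Context {R : realType}.

(* The library norm on ['rV[R]_n] and on products is the sup norm (same
   topology); Euclidean quantities are introduced separately. *)
Definition dotv {n : nat} (u v : 'rV[R]_n) : R := \sum_(i < n) u 0 i * v 0 i.

Definition gradient {n : nat} (f : 'rV[R]_n -> R) (x : 'rV[R]_n) : 'rV[R]_n :=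
  \row_(i < n) 'D_(delta_mx 0 i) f x.

(* For a linear subspace [T] of R^n such a [p] exists and is unique. *)
Definition orth_proj {n : nat} (T : set 'rV[R]_n) (g : 'rV[R]_n) : 'rV[R]_n :=
  get [set p | T p /\ forall v, T v -> dotv (g - p) v = 0].

(* C^k on an open subset [A] of a finite-dimensional space [V]. *)
Fixpoint Ck_on {V W : normedModType R} (k : nat) (A : set V) (f : V -> W)
    : Prop :=
  match k with
  | 0 => forall x, A x -> {for x, continuous f}
  | k'.+1 => (forall x, A x -> differentiable f x) /\
             (forall v : V, Ck_on k' A (fun x => 'D_v f x))
  end.

Definition smooth_on {V W : normedModType R} (A : set V) (f : V -> W) : Prop :=
  forall k, Ck_on k A f.

End EuclideanSpace.

Section Submanifolds.
Context {R : realType} {n : nat}.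
Implicit Types (M : set 'rV[R]_n) (x : 'rV[R]_n).

(* [phi : A -> B] is a diffeomorphism of open subsets of R^n (with inverse
   [psi]) that straightens [M] near [x] onto the coordinate plane
   R^d x {0}.  There are no half-space charts, hence no boundary. *)
Definition slice_chart_at (d : nat) M x : Prop :=
  exists (A B : set 'rV[R]_n) (phi psi : 'rV[R]_n -> 'rV[R]_n),
    [/\ open A, A x & open B] /\
    [/\ smooth_on A phi, smooth_on B psi,
        (forall u, A u -> B (phi u) /\ psi (phi u) = u) &
        (forall v, B v -> A (psi v) /\ phi (psi v) = v)] /\
    (forall u, A u -> (M u <-> forall i : 'I_n, (d <= i)%N -> phi u 0 i = 0)).

Definition embedded_submanifold M : Prop :=
  exists2 d : nat, (d <= n)%N & forall x, M x -> slice_chart_at d M x.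

(* T_x M: velocities at time 0 of smooth curves in [M] through [x]. *)
Definition tangent_space M x : set 'rV[R]_n :=
  [set v | exists (e : R) (c : R -> 'rV[R]_n),
     [/\ 0 < e, smooth_on `]-e, e[%classic c,
         (forall t, `]-e, e[%classic t -> M (c t)), c 0 = x &
         is_derive (0 : R) (1 : R) c v]].

Definition riem_gradient M (f : 'rV[R]_n -> R) x : 'rV[R]_n :=
  orth_proj (tangent_space M x) (gradient f x).

Definition crit M (f : 'rV[R]_n -> R) : set 'rV[R]_n :=
  [set x | M x /\ riem_gradient M f x = 0].

(* A map on [M] is smooth when it locally extends to a smooth map on an open
   subset of R^n.  Values of [b] off [M] are irrelevant. *)
Definition smooth_vector_field M (b : 'rV[R]_n -> 'rV[R]_n) : Prop :=
  (forall x, M x -> tangent_space M x (b x)) /\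
  (forall x, M x -> exists (A : set 'rV[R]_n) (g : 'rV[R]_n -> 'rV[R]_n),
     [/\ open A, A x, smooth_on A g & forall u, M u -> A u -> g u = b u]).

Definition unique_minimizer M (f : 'rV[R]_n -> R) (xs : 'rV[R]_n) : Prop :=
  M xs /\ forall x, M x -> x <> xs -> f xs < f x.

End Submanifolds.

Section Synergistic.
Context {R : realType} {n N : nat}.

(* The index set Q is ['I_N.+1], so that it is nonempty. *)
Definition minQ (f : 'I_N.+1 -> R) : R := \big[Num.min/f ord0]_(q < N.+1) f q.
Definition maxQ (f : 'I_N.+1 -> R) : R := \big[Num.max/f ord0]_(q < N.+1) f q.

(* When every critical set is finite this infimum is a minimum, or [+oo] if no
   function of the family has a critical point other than [xs]. *)
Definition synergy_gap (M : set 'rV[R]_n) (xs : 'rV[R]_n)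
    (Jt : 'I_N.+1 -> 'rV[R]_n -> R) : \bar R :=
  ereal_inf [set g | exists (q1 : 'I_N.+1) (x : 'rV[R]_n),
    [/\ crit M (Jt q1) x, x <> xs &
        g = (maxQ (fun q2 => Jt q1 x - Jt q2 x))%:E]].

Definition synergistic_family (M U : set 'rV[R]_n) (J : 'rV[R]_n -> R)
    (xs : 'rV[R]_n) (Jbar delta : R) (Jt : 'I_N.+1 -> 'rV[R]_n -> R) : Prop :=
  [/\ (forall q, [/\ smooth_on U (Jt q), unique_minimizer M (Jt q) xs &
                     finite_set (crit M (Jt q))]),
      (forall q x, M x -> J x < Jbar + J xs -> Jt q x = J x),
      0 < delta & (delta%:E < synergy_gap M xs Jt)%E].

End Synergistic.

Section HybridSystems.
Context {R : realType}.

Record hds (E : Type) := HDS {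
  flow_set : set E;
  flow_map : E -> set E;
  jump_set : set E;
  jump_map : E -> set E }.

Definition compact_hybrid_time_domain (S : set (R * nat)) : Prop :=
  exists (m : nat) (t : nat -> R),
    [/\ t 0%N = 0, (forall j, (j < m)%N -> t j <= t j.+1) &
        S = [set p | (p.2 < m)%N /\ t p.2 <= p.1 <= t p.2.+1]].

Definition hybrid_time_domain (S : set (R * nat)) : Prop :=
  (forall p, S p -> 0 <= p.1) /\
  (forall T m, S (T, m) -> compact_hybrid_time_domain
     (S `&` [set p | 0 <= p.1 <= T /\ (p.2 <= m)%N])).

Definition abs_continuous {E : normedModType R} (a b : R) (f : R -> E) : Prop :=
  forall e : R, 0 < e -> exists2 d : R, 0 < d &
    forall (m : nat) (u v : 'I_m -> R),
      (forall k, [/\ a <= u k, u k <= v k & v k <= b]) ->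
      trivIset [set: 'I_m] (fun k => `]u k, v k[%classic) ->
      \sum_(k < m) (v k - u k) < d ->
      \sum_(k < m) `|f (v k) - f (u k)| < e.

Definition loc_abs_continuous {E : normedModType R} (I : set R) (f : R -> E)
    : Prop :=
  forall a b : R, a <= b -> `[a, b]%classic `<=` I -> abs_continuous a b f.

(* [y] is total; only its values on [dom] matter.  The two-sided derivative is
   required almost everywhere on I_j only, so endpoints play no role. *)
Definition hds_solution {E : normedModType R} (H : hds E)
    (dom : set (R * nat)) (y : R -> nat -> E) : Prop :=
  let I (j : nat) : set R := [set t | dom (t, j)] in
  [/\ hybrid_time_domain dom,
      dom (0, 0%N) /\ (flow_set H `|` jump_set H) (y 0 0%N),
      (forall j, interior (I j) !=set0 ->
         [/\ loc_abs_continuous (I j) (y ^~ j),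
             (forall t, I j t -> flow_set H (y t j)) &
             {ae (@lebesgue_measure R), forall t, I j t ->
                exists2 v, flow_map H (y t j) v &
                  is_derive (t : R) (1 : R) (y ^~ j) v}]) &
      (forall t j, dom (t, j) -> dom (t, j.+1) ->
         jump_set H (y t j) /\ jump_map H (y t j) (y t j.+1))].

Definition class_KL (beta : R -> R -> R) : Prop :=
  [/\ (forall r s, 0 <= r -> 0 <= s -> 0 <= beta r s),
      (forall r1 r2 s, 0 <= r1 -> r1 <= r2 -> 0 <= s ->
         beta r1 s <= beta r2 s),
      (forall r s1 s2, 0 <= r -> 0 <= s1 -> s1 <= s2 ->
         beta r s2 <= beta r s1),
      (forall s, 0 <= s -> beta r s @[r --> 0^'+] --> 0) &
      (forall r, 0 <= r -> beta r s @[s --> +oo] --> 0)].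

(* |theta|_A for A a compact subset of R^n x R, with the Euclidean norm of
   R^(n+1); the infimum is then attained. *)
Definition dist_set {n : nat} (A : set ('rV[R]_n * R)) (th : 'rV[R]_n * R) : R :=
  inf [set Num.sqrt (dotv (th.1 - a.1) (th.1 - a.1) + (th.2 - a.2) ^+ 2)
      | a in A].

(* States are [(theta, tau)] with [theta] in R^n x R. *)
Definition GPAS {n : nat} {F : normedModType R}
    (H : R -> hds ('rV[R]_n * R * F)%type) (A : set ('rV[R]_n * R)) : Prop :=
  exists2 beta : R -> R -> R, class_KL beta &
    forall nu : R, 0 < nu -> exists2 eps0 : R, 0 < eps0 &
      forall eps : R, 0 < eps -> eps <= eps0 ->
      forall (dom : set (R * nat)) (y : R -> nat -> ('rV[R]_n * R * F)%type),
        hds_solution (H eps) dom y ->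
        forall t j, dom (t, j) ->
          dist_set A (y t j).1 <=
          beta (dist_set A (y 0 0%N).1) (t + j%:R) + nu.

End HybridSystems.

Section ExtremumSeeking.
Context {R : realType} {n r N : nat}.
Variables (M : set 'rV[R]_n) (b : 'I_r -> 'rV[R]_n -> 'rV[R]_n)
  (w : 'I_r -> rat) (kappa delta : R) (Jt : 'I_N.+1 -> 'rV[R]_n -> R).

(* Q = {1, ..., N+1} as a subset of R: the logic variable is a real coordinate
   of the state, so that it can be differentiated along flows. *)
Definition label (q : 'I_N.+1) : R := q.+1%:R.

Definition es_C : set ('rV[R]_n * R) :=
  [set th | M th.1 /\ exists2 q, th.2 = label q &
    Jt q th.1 - minQ (Jt ^~ th.1) <= delta].

Definition es_D : set ('rV[R]_n * R) :=
  [set th | M th.1 /\ exists2 q, th.2 = label q &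
    Jt q th.1 - minQ (Jt ^~ th.1) >= delta].

Definition nonneg2 : set (R * R) := [set tau | 0 <= tau.1 /\ 0 <= tau.2].

Definition es_flow_x (eps : R) (q : 'I_N.+1) (x : 'rV[R]_n) (tau2 : R)
    : 'rV[R]_n :=
  \sum_(i < r)
    (eps^-1 * Num.sqrt (2 * ratr (w i))
     * cos (kappa * Jt q x + ratr (w i) * tau2) * (Num.sqrt kappa)^-1) *: b i x.

Definition es_system (eps : R) : hds ('rV[R]_n * R * (R * R))%type :=
  {| flow_set := es_C `*` nonneg2;
     flow_map := fun s => [set v | exists2 q, s.1.2 = label q &
       v = ((es_flow_x eps q s.1.1 s.2.2, 0), (eps^-1, eps ^- 2))];
     jump_set := es_D `*` nonneg2;
     jump_map := fun s => [set s' | exists2 q,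
       Jt q s.1.1 = minQ (Jt ^~ s.1.1) & s' = ((s.1.1, label q), s.2)] |}.

Definition es_attractor (xs : 'rV[R]_n) : set ('rV[R]_n * R) :=
  [set xs] `*` range label.

End ExtremumSeeking.

Arguments es_attractor {R n} N xs.

(* Main.v *)
(* The averaging is carried out on Lyapunov functions instead of trajectories.
   Write h_i for the derivative of Jt_q along b_i and phi_i = kappa Jt_q + w_i tau_2.
   Along a flow in mode q,
     d/dt Jt_q = eps^-1 \sum_i sqrt (2 w_i / kappa) h_i cos phi_i,
   and this fast term is removed by subtracting
     eps \sum_i sqrt (2 w_i / kappa) / w_i h_i sin phi_i.
   What remains at order 1 is a trigonometric polynomial in tau_2 with mean
   - \sum_i h_i^2 (the w_i being positive and distinct), and its oscillating part is
   removed by a further correction of order eps^2.  The perturbed function thus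
   satisfies d/dt W_q <= - \sum_i h_i^2 + O(eps) and |W_q - Jt_q| = O(eps).  By (3)
   the sum \sum_i h_i^2 vanishes only at critical points of Jt_q, and the synergy
   gap keeps these out of the flow set, except xs: W_q decreases at a uniform rate
   while Jt_q - J xs >= rho.  A jump lowers Jt_q by at least delta, so flowing and
   jumping together give W <= max (J xs + rho / 2, W(0,0) - a (t + j)). *)
Require Import Defs.
From HB Require Import structures.
From mathcomp Require Import all_boot all_order all_algebra.
From mathcomp Require Import all_classical all_reals all_analysis.
From mathcomp Require Import ring lra.

Import Order.TTheory GRing.Theory Num.Theory.
Import numFieldNormedType.Exports.

Local Open Scope classical_set_scope.
Local Open Scope ring_scope.

(** * Absolutely continuous curves *)

Section AbsolutelyContinuous.
Context {R : realType}.

Lemma negligible_open_cover (A : set R) (d : R) :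
  (@lebesgue_measure R).-negligible A -> 0 < d ->
  exists O : set R, [/\ open O, A `<=` O & (lebesgue_measure O < d%:E)%E].
Proof.
move=> [B [mB B0 AB]] d0.
have [|O [oO BO mO]] := lebesgue_regularity_outer mB _ d0.
  have lt0 (x : \bar R) : x = 0%E -> (x < +oo)%E by move=> ->.
  exact: lt0 B0. 
exists O; split => //; first exact: subset_trans BO.
have mOm : measurable O by exact: measurable_realfun.open_measurable.
rewrite -(setDUK BO) measureU//; last 2 first.
- exact: measurableD.
- by rewrite setDE setICA setICr setI0.
have add0 (x y : \bar R) : x = 0%E -> (x + y)%E = y by move=> ->; rewrite add0e.
by rewrite (add0 _ _ B0).
Qed.

Lemma disjoint_itv_length_le (O : set R) (m : nat) (u v : 'I_m -> R) :
  measurable O ->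
  (forall k, u k <= v k) -> (forall k, `]u k, v k[%classic `<=` O) ->
  trivIset [set: 'I_m] (fun k => `]u k, v k[%classic) ->
  ((\sum_(k < m) (v k - u k))%:E <= lebesgue_measure O)%E.
Proof.
move=> mO uv uvO tI.
have mU : measurable (\bigcup_(k in [set: 'I_m]) `]u k, v k[%classic).
  by apply: fin_bigcup_measurable; [exact: finite_finset|move=> k _]; exact: measurable_itv.
apply: (@le_trans _ _
  (lebesgue_measure (\bigcup_(k in [set: 'I_m]) `]u k, v k[%classic))); last first.
  by apply: le_measure; rewrite ?inE//; apply: bigcup_sub => k _; exact: uvO.
rewrite measure_fin_bigcup//; last exact: finite_finset.
have -> : [set: 'I_m] = [set` enum 'I_m].
  by apply/seteqP; split => // k _ /=; rewrite mem_enum.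
rewrite -fsbig_seq ?enum_uniq// big_enum/= -sumEFin lee_sum// => k _.
rewrite lebesgue_measure_itv/= lte_fin.
by have := uv k; rewrite le_eqVlt => /predU1P[->|->//]; rewrite ltxx subrr.
Qed.

(** A division-free form of the derivative. With its converse [near_expansion_is_derive] it lets
    derivatives pass through interval estimates and through norm-decreasing linear maps. *)
Lemma is_derive_near_expansion {E : normedModType R} (f : R -> E) (t e : R) (v : E) :
  0 < e -> is_derive t 1 f v ->
  \forall s \near t, `|f s - f t - (s - t) *: v| <= e * `|t - s|.
Proof.
move=> e_gt0 ft.
have /cvgrPdist_le/(_ _ e_gt0) : h^-1 *: ((f \o shift t) (h *: 1) - f t) @[h --> 0^'] --> v.
  by have [fd <-] := ft; exact: fd.
move=> /nbhs_ballP[h /= h_gt0 hh].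
apply/nbhs_ballP; exists h => //= s; rewrite /ball/= => ts.
have [->|st] := eqVneq s t; first by rewrite !subrr scale0r subr0 !normr0 mulr0.
have st0 : s - t != 0 by rewrite subr_eq0.
have := hh (s - t); rewrite /ball/= sub0r normrN distrC => /(_ ts st0).
rewrite [_ *: 1]mulr1 subrK => le_e.
have -> : f s - f t - (s - t) *: v = - ((s - t) *: (v - (s - t)^-1 *: (f s - f t))).
  by rewrite scalerBr scalerA divff// scale1r opprB.
by rewrite normrN normrZ mulrC [`|t - s|]distrC ler_wpM2r.
Qed.

(* Cousin's argument: a supremum over [a, b] builds a chain of intervals tagged
   either by a point where f' is within c of w, or by a point of the exceptional
   null set; the latter intervals lie in a small open set V, so that absolute
   continuity bounds their total contribution. *)
Lemma ac_mean_value {E : normedModType R} (f : R -> E) (w : E) (a b c : R) :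
  a <= b -> 0 <= c -> abs_continuous a b f ->
  {ae (@lebesgue_measure R), forall t, a <= t <= b ->
     exists2 v, is_derive (t : R) (1 : R) f v & `|v - w| <= c} ->
  `|f b - f a - (b - a) *: w| <= c * (b - a).
Proof.
move=> leab c_ge0 fac fder.
apply/ler_addgt0Pr => e0 e0_gt0.
(* The error budget is [e * (b - a)] from the good intervals, [e] from the variation of [f] over the
   exceptional ones, and [e] from [|w|] times their total length; the second bound in [d'] below
   serves the last. *)
pose e := e0 / (b - a + 1 + 1).
have D_gt0 : 0 < b - a + 1 + 1 by lra.
have e_gt0 : 0 < e by rewrite divr_gt0.
have [d d_gt0 fd] := fac _ e_gt0.
pose d' := Num.min d (e / (`|w| + 1)).
have w1_gt0 : 0 < `|w| + 1 by rewrite ltr_pwDr.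
have d'_gt0 : 0 < d' by rewrite lt_min d_gt0 divr_gt0.
have [V [oV NV mV]] := negligible_open_cover _ _ fder d'_gt0.
pose inc (p : R * R) := `|f p.2 - f p.1| + `|w| * (p.2 - p.1).
(* [l] lists, in increasing order, the exceptional intervals of a chain from [a] to [s]; the rest of
   the chain costs at most [c + e] per unit length. *)
pose G s := a <= s <= b /\ exists l : seq (R * R),
  [/\ all (fun p : R * R => (a <= p.1) && (p.1 <= p.2) && (p.2 <= s)) l,
      pairwise (fun p q : R * R => p.2 <= q.1) l,
      (forall p, p \in l -> `]p.1, p.2[%classic `<=` V) &
      `|f s - f a - (s - a) *: w| <= (c + e) * (s - a) + \sum_(p <- l) inc p].
have stepG u v : a <= u -> u <= v -> v <= b ->
    `|f v - f u - (v - u) *: w| <= (c + e) * (v - u) \/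
    `]u, v[%classic `<=` V -> G u -> G v.
  move=> au uv vb good [_ [l [lu lp lV ls]]]; split; first by rewrite vb (le_trans au).
  have split_diff : f v - f a - (v - a) *: w =
      (f u - f a - (u - a) *: w) + (f v - f u - (v - u) *: w).
    rewrite addrACA -opprD -scalerDl; congr (_ - _ *: _); last by ring.
    by rewrite addrC subrKA.
  have lv : all (fun p : R * R => (a <= p.1) && (p.1 <= p.2) && (p.2 <= v)) l.
    by apply: sub_all lu => p /andP[-> /= /le_trans->].
  have [goodt|badt] := good.
    exists l; split => //.
    rewrite split_diff (le_trans (ler_normD _ _))//.
    rewrite (le_trans (lerD ls goodt))//; lra.
  exists (rcons l (u, v)); split => //.
  - by rewrite all_rcons lv /= au uv lexx.
  - rewrite pairwise_rcons lp andbT; apply: sub_all lu => p /andP[_ +] /=.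
    by [].
  - by move=> p; rewrite mem_rcons inE => /predU1P[->//|/lV].
  - rewrite big_rcons/= split_diff (le_trans (ler_normD _ _))//.
    have ce_ge0 : 0 <= (c + e) * (v - u) by rewrite mulr_ge0 ?subr_ge0// addr_ge0// ltW.
    have h : `|f v - f u - (v - u) *: w| <= inc (u, v).
      rewrite (le_trans (ler_normB _ _))// /inc/= lerD2l normrZ mulrC ger0_norm// subr_ge0//.
    rewrite (le_trans (lerD ls h))//; lra.
have localG t : a <= t <= b -> exists2 h : R, 0 < h &
    forall u v, a <= u -> t - h < u -> u <= t -> t <= v -> v < t + h -> v <= b -> G u -> G v.
  move=> tab.
  have [gt|bt] :=
    pselect (exists2 v, is_derive (t : R) (1 : R) f v & `|v - w| <= c); last first.
    have Vt : V t by apply: NV => /(_ tab)/bt.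
    have /nbhs_ballP[h /= h_gt0 hV] : nbhs t V by exact: open_nbhs_nbhs.
    exists h => // u v au uh ut tv vh vb; apply: stepG => //; first exact: le_trans tv.
    right => s /=; rewrite in_itv/= => /andP[us sv]; apply: hV.
    by rewrite /ball/= ltr_norml; lra.
  have [v0 ft v0w] := gt.
  have : \forall s \near t, `|f s - f t - (s - t) *: v0| <= e * `|t - s|.
    exact: is_derive_near_expansion.
  move=> /nbhs_ballP[h /= h_gt0 hh]; exists h => // u v au uh ut tv vh vb.
  apply: stepG => //; first exact: le_trans tv.
  left.
  have hu : `|f u - f t - (u - t) *: v0| <= e * (t - u).
    have := hh u; rewrite [X in _ * X]ger0_norm ?subr_ge0//; apply.
    by rewrite /ball/= ger0_norm ?subr_ge0//; lra.
  have hv : `|f v - f t - (v - t) *: v0| <= e * (v - t).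
    have := hh v; rewrite [X in _ * X]ler0_norm ?subr_le0// opprB; apply.
    by rewrite /ball/= ler0_norm ?subr_le0//; lra.
  (* Both ends are compared with the tag [t] through the derivative [v0], and then [v0] with [w]. *)
  have -> : f v - f u - (v - u) *: w = (f v - f t - (v - t) *: v0) -
      (f u - f t - (u - t) *: v0) + (v - u) *: (v0 - w).
    have regroup (Z : zmodType) (X Y A B C : Z) :
        X - Y - C = (X - A) - (Y - B) + (A - B - C).
      rewrite [RHS]addrA; congr (_ - _).
      by rewrite opprB -addrA [B - Y + _]addrC !subrKA.
    rewrite -[f v - f u](subrKA (f t)) -[f t - f u]opprB scalerBr.
    rewrite (regroup _ _ _ ((v - t) *: v0) ((u - t) *: v0)).
    suff -> : (v - u) *: v0 = (v - t) *: v0 - (u - t) *: v0 by [].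
    by rewrite -scalerBl; congr (_ *: _); ring.
  rewrite (le_trans (ler_normD _ _))// (le_trans (lerD (ler_normB _ _) (lexx _)))//.
  rewrite (le_trans (lerD (lerD hv hu) (lexx _)))// normrZ ger0_norm ?subr_ge0 ?(le_trans ut)//.
  have : (v - u) * `|v0 - w| <= (v - u) * c by rewrite ler_wpM2l ?subr_ge0 ?(le_trans ut).
  lra.
have Ga : G a.
  split; first by rewrite lexx.
  by exists [::]; split => //; rewrite !subrr scale0r subr0 normr0 big_nil mulr0 addr0.
(* A point of [G] just below [t] can be continued past [t] by [localG], which contradicts the
   supremum unless [t = b]. *)
pose t := sup G.
have hsG : has_sup G by split; [exists a|exists b => s [/andP[]]].
have tab : a <= t <= b.
  rewrite sup_upper_bound//=; apply: ge_sup; first by exists a.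
  by move=> s [/andP[]].
have [h h_gt0 Gh] := localG _ tab.
have [u Gu tu] := sup_adherent h_gt0 hsG.
have ut : u <= t by exact: sup_upper_bound.
have au : a <= u by case: Gu => /andP[].
have Gb : G b.
  have [tb|bt] := ltP t b; last first.
    have tb : t = b by apply/le_anti; rewrite bt (andP tab).2.
    by apply: (Gh u b); rewrite ?tb// -?tb// ltrDl.
  pose v := Num.min b (t + h / 2).
  have tv : t < v by rewrite lt_min tb ltrDl divr_gt0.
  have Gv : G v.
    apply: (Gh u v) => //; first exact: ltW.
      by rewrite gt_min; apply/orP; right; rewrite ltrD2l; lra.
    by rewrite ge_min lexx.
  by have := sup_upper_bound hsG Gv; rewrite leNgt tv.
have [_ [l [lab lp lV /le_trans]]] := Gb; apply.
have lab' (i : 'I_(size l)) : a <= (l`_i).1 /\ (l`_i).1 <= (l`_i).2 /\ (l`_i).2 <= b.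
  by have /allP/(_ _ (mem_nth 0 (ltn_ord i)))/andP[/andP[]] := lab.
have ltriv : trivIset [set: 'I_(size l)] (fun k => `](l`_k).1, (l`_k).2[%classic).
  apply/trivIsetP => i j _ _.
  wlog ij : i j / (i < j)%N.
    move=> H ij0; have [/H/(_ ij0)//|ji|/val_inj e'] := ltngtP i j; last first.
      by rewrite e' eqxx in ij0.
    by rewrite setIC; apply: H => //; rewrite eq_sym.
  move=> _.
  have /(pairwiseP 0)/(_ _ _ (ltn_ord i) (ltn_ord j) ij) lij := lp.
  rewrite -subset0 => s [/=]; rewrite !in_itv/= => /andP[_ si] /andP[js _].
  by have := lt_le_trans (lt_trans js si) lij; rewrite ltxx.
have llen : \sum_(k < size l) ((l`_k).2 - (l`_k).1) < d'.
  rewrite -lte_fin; apply: le_lt_trans mV; apply: disjoint_itv_length_le => //.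
  - exact: measurable_realfun.open_measurable.
  - by move=> k; have [_ []] := lab' k.
  - by move=> k; apply: lV; exact: mem_nth.
rewrite (big_nth 0) big_mkord big_split/= -mulr_sumr.
have h1 : \sum_(k < size l) `|f (l`_k).2 - f (l`_k).1| < e.
  apply: fd => //; first by move=> k; have [? []] := lab' k.
  by move: llen; rewrite lt_min => /andP[].
have h2 : `|w| * \sum_(k < size l) ((l`_k).2 - (l`_k).1) <= e.
  rewrite (le_trans (ler_wpM2l _ (ltW llen)))// (@le_trans _ _ (`|w| * (e / (`|w| + 1))))//.
    by rewrite ler_wpM2l// ge_min lexx orbT.
  rewrite mulrC -mulrA ler_piMr ?ltW// mulrC ltr_pdivrMr// mul1r ltrDl//.
have -> : e0 = e * (b - a + 1 + 1) by rewrite /e divfK// gt_eqF.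
lra.
Qed.


Lemma near_expansion_is_derive {E : normedModType R} (f : R -> E) (t : R) (v : E) :
  (forall e : R, 0 < e ->
    \forall s \near t, `|f s - f t - (s - t) *: v| <= e * `|t - s|) ->
  is_derive t 1 f v.
Proof.
move=> fv.
have cv : h^-1 *: ((f \o shift t) (h *: 1) - f t) @[h --> 0^'] --> v.
  apply/cvgrPdist_le => e e_gt0.
  have /nbhs_ballP[d /= d_gt0 hd] := fv _ e_gt0.
  apply/nbhs_ballP; exists d => //= h; rewrite /ball/= sub0r normrN => hlt h0.
  have := hd (h + t); rewrite /ball/= opprD addrC subrK normrN => /(_ hlt).
  rewrite addrK [_ *: 1]mulr1 => le_e.
  have -> : v - h^-1 *: (f (h + t) - f t) = - (h^-1 *: (f (h + t) - f t - h *: v)).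
    by rewrite [in RHS]scalerBr scalerA mulVf// scale1r opprB.
  by rewrite normrN normrZ normfV mulrC ler_pdivrMr ?normr_gt0.
split; first by apply/cvg_ex; exists v.
exact: cvg_lim.
Qed.

Lemma sub_abs_continuous {E : normedModType R} (f : R -> E) (a b a' b' : R) :
  a <= a' -> b' <= b -> abs_continuous a b f -> abs_continuous a' b' f.
Proof.
move=> aa' bb' fac e /fac[d d_gt0 fd]; exists d => // m u v uv; apply: fd => k.
by have [au ukvk vb] := uv k; split; [exact: le_trans au| |exact: le_trans bb'].
Qed.

Lemma abs_continuous_continuous {E : normedModType R} (f : R -> E) (a b : R) :
  abs_continuous a b f -> {within `[a, b], continuous f}.
Proof.
move=> fac; apply/subspace_continuousP => t /=; rewrite in_itv/= => /andP[at_ tb].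
apply/cvgrPdist_lt => e /fac[d d_gt0 fd].
rewrite near_withinE; apply/nbhs_ballP; exists d => //= s ts.
rewrite /= in_itv/= => /andP[as_ sb].
have := fd 1%N (fun=> Num.min s t) (fun=> Num.max s t).
rewrite !big_ord1 /= => H.
have [st|st] := leP s t.
  move: H; rewrite (min_idPl st) (max_idPr st); apply.
  - by move=> k; split.
  - by apply/trivIsetP => i j _ _; rewrite !ord1 eqxx.
  - by move: ts; rewrite /ball/= ger0_norm ?subr_ge0.
move: H; rewrite (min_idPr (ltW st)) (max_idPl (ltW st)) distrC; apply.
- by move=> k; split => //; exact: ltW.
- by apply/trivIsetP => i j _ _; rewrite !ord1 eqxx.
- by move: ts; rewrite /ball/= distrC gtr0_norm ?subr_gt0.
Qed.

(** On a short interval around [t] the values of [g] are within [e] of [g t], so the mean value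
    inequality bounds the increments of [f]. This upgrades a flow equation valid almost everywhere
    to one valid at every interior time, as the chain rule requires. *)
Lemma ac_derive_continuous {E : normedModType R} (f g : R -> E) (a b : R) :
  abs_continuous a b f -> {within `[a, b], continuous g} ->
  {ae (@lebesgue_measure R), forall t, a <= t <= b -> is_derive (t : R) (1 : R) f (g t)} ->
  forall t, a < t < b -> is_derive t 1 f (g t).
Proof.
move=> fac gc fg t /andP[at_ tb]; apply: near_expansion_is_derive => e e_gt0.
have /subspace_continuousP/(_ t) := gc; rewrite /= in_itv/= !ltW// => /(_ isT).
move=> /cvgrPdist_le/(_ _ e_gt0); rewrite near_withinE => /nbhs_ballP[d /= d_gt0 gd].
pose d' := Num.min d (Num.min (t - a) (b - t)).
have mv u v : a <= u -> u <= v -> v <= b -> `|t - u| < d -> `|t - v| < d ->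
    `|f v - f u - (v - u) *: g t| <= e * (v - u).
  move=> au uv vb tu tv; apply: ac_mean_value => //; first exact: ltW.
    exact: sub_abs_continuous fac.
  apply: (negligibleS _ fg); apply: subsetC => s fs /andP[us sv].
  have sab : a <= s <= b by rewrite (le_trans au)//= (le_trans sv).
  exists (g s); first exact: fs.
  rewrite distrC; apply: gd => //; rewrite /ball/=.
  by move: tu tv; rewrite !ltr_norml; lra.
have d'_gt0 : 0 < d' by rewrite !lt_min d_gt0 !subr_gt0 at_.
apply/nbhs_ballP; exists d' => //= s; rewrite /ball/= !lt_min => /and3P[tsd tsa tsb].
have sab : a <= s <= b.
  by move: tsa tsb; rewrite !ltr_norml; lra.
have [as_ sb] := andP sab.
have [st|st] := leP s t.
  have := mv s t as_ st (ltW tb) tsd; rewrite subrr normr0 => /(_ d_gt0).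
  have -> : f s - f t - (s - t) *: g t = - (f t - f s - (t - s) *: g t).
    by rewrite -scaleNr [- (s - t)]opprB opprD opprK opprB.
  rewrite normrN => /le_trans; apply.
  by rewrite ler_wpM2l ?ler_norm// ltW.
have := mv t s (ltW at_) (ltW st) sb; rewrite subrr normr0 => /(_ d_gt0 tsd)/le_trans; apply.
by rewrite ler_wpM2l ?(ltW e_gt0)// distrC ler_norm.
Qed.

End AbsolutelyContinuous.

(** * Smooth functions and Lie derivatives on submanifolds *)

Lemma near_eq_differentiable {R : realType} {V W : normedModType R} (f g : V -> W) (x : V) :
  (\near x, f x = g x) -> differentiable f x -> differentiable g x.
Proof.
move=> fg /diff_locallyP[fc fo].
have go : g \o shift x = cst (g x) + 'd f x +o_ (0 : V) id.
  apply/eqaddoP => e e_gt0; move/eqaddoP : fo => /(_ _ e_gt0).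
  have fg0 : \forall h \near (0 : V), f (h + x) = g (h + x).
    by rewrite (near_shift x)/=; apply: filterS fg => z; rewrite /= sub0r subrK.
  apply: filterS2 fg0 => h fgh; rewrite /= !fctE /= fgh.
  by rewrite -(nbhs_singleton fg).
apply/diff_locallyP; rewrite (diff_unique _ go)//; exact: fc.
Qed.

Section SmoothCalculus.
Context {R : realType} {V : normedModType R}.
Implicit Types (A : set V).

Lemma Ck_onW {W : normedModType R} (k : nat) A (f : V -> W) :
  Ck_on k.+1 A f -> Ck_on k A f.
Proof.
elim: k f => [f [fd _] x Ax|k IH f [fd fD]]; first exact/differentiable_continuous/fd.
by split => // v; apply/IH/fD.
Qed.

Lemma Ck_on_sub {W : normedModType R} (k : nat) A A' (f : V -> W) :
  A' `<=` A -> Ck_on k A f -> Ck_on k A' f.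
Proof.
move=> AA'; elim: k f => [f fc x /AA'/fc//|k IH f [fd fD]].
by split => [x /AA'/fd//|v]; exact/IH/fD.
Qed.

(** Formulas for derivatives, such as the Leibniz rule, hold only at points of [A]; this allows the
    inductions on [k] to replace the derivative by the formula. Openness turns equality on [A] into
    equality near each of its points. *)
Lemma Ck_on_ext {W : normedModType R} (k : nat) A (f g : V -> W) :
  open A -> {in A, f =1 g} -> Ck_on k A f -> Ck_on k A g.
Proof.
move=> oA; elim: k f g => [|k IH] f g fg.
  move=> fc x Ax; have fgx : \near x, f x = g x.
    by near=> y; apply: fg; rewrite inE; near: y; exact: open_nbhs_nbhs.
  move: (fc x Ax); rewrite /prop_for /continuous_at fg ?inE//; apply: cvg_trans.
  by apply: near_eq_cvg; exact: filterS fgx.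
move=> [fd fD]; have fgx x : A x -> \near x, f x = g x.
  by move=> Ax; near=> y; apply: fg; rewrite inE; near: y; exact: open_nbhs_nbhs.
split => [x Ax|v].
  exact: near_eq_differentiable (fgx _ Ax) (fd _ Ax).
apply: IH (fD v) => x; rewrite inE => Ax.
exact/near_eq_derive/fgx.
Unshelve. all: by end_near. Qed.

Lemma Ck_onD {W : normedModType R} (k : nat) A (f g : V -> W) :
  open A -> Ck_on k A f -> Ck_on k A g -> Ck_on k A (f \+ g).
Proof.
move=> oA; elim: k f g => [|k IH] f g.
  by move=> fc gc x Ax; apply: cvgD; [exact: fc|exact: gc].
move=> [fd fD] [gd gD]; split => [x Ax|v].
  by apply: differentiableD; [exact: fd|exact: gd].
apply: (@Ck_on_ext _ _ _ ('D_v f \+ 'D_v g)) => //; last by apply: IH; [exact: fD|exact: gD].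
move=> x; rewrite inE => Ax; rewrite /= -deriveD//; apply: diff_derivable.
  exact: fd.
exact: gd.
Qed.

Lemma Ck_onM (k : nat) A (f g : V -> R) :
  open A -> Ck_on k A f -> Ck_on k A g -> Ck_on k A (f \* g).
Proof.
move=> oA; elim: k f g => [|k IH] f g.
  by move=> fc gc x Ax; apply: cvgM; [exact: fc|exact: gc].
move=> /[dup] /Ck_onW fk [fd fD] /[dup] /Ck_onW gk [gd gD]; split => [x Ax|v].
  by apply: differentiableM; [exact: fd|exact: gd].
apply: (@Ck_on_ext _ _ _ ((f \* 'D_v g) \+ (g \* 'D_v f))) => //.
  move=> x; rewrite inE => Ax; rewrite /= (deriveM (f := f) (g := g))//; apply: diff_derivable.
    exact: fd.
  exact: gd.
by apply: Ck_onD => //; apply: IH => //; [exact: gD|exact: fD].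
Qed.

Lemma smooth_on_coord {n : nat} A (f : V -> 'rV[R]_n) (j : 'I_n) :
  open A -> smooth_on A f -> smooth_on A (fun x => f x 0 j).
Proof.
move=> oA sf k; elim: k f {sf}(sf k) => [|k IH] f.
  move=> fc x Ax; apply: (@continuous_comp _ _ _ f (fun M : 'rV[R]_n => M 0 j)); first exact: fc.
  exact: coord_continuous.
move=> [fd fD]; split => [x Ax|v].
  apply: (@differentiable_comp _ _ _ _ f (fun M : 'rV[R]_n => M 0 j)); first exact: fd.
  exact: differentiable_coord.
apply: (@Ck_on_ext _ _ _ (fun x => 'D_v f x 0 j)) => //; last by apply: IH; exact: fD.
move=> x; rewrite inE => Ax; rewrite derive_mx ?mxE//.
exact/diff_derivable/fd.
Qed.

Lemma smooth_on_sum (I : Type) (s : seq I) A (f : I -> V -> R) :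
  open A -> (forall i, smooth_on A (f i)) ->
  smooth_on A (fun x => \sum_(i <- s) f i x).
Proof.
move=> oA sf k; elim: s => [|i s IH].
  apply: (@Ck_on_ext _ _ _ (cst 0)) => //; first by move=> x; rewrite big_nil.
  elim: k => [|k IHk]; first by move=> x _; exact: cst_continuous.
  split => [x _|v]; first exact: differentiable_cst.
  by apply: Ck_on_ext IHk => // x _; rewrite derive_cst.
apply: (@Ck_on_ext _ _ _ (f i \+ (fun x => \sum_(i <- s) f i x))) => //.
  by move=> x _; rewrite big_cons.
by apply: Ck_onD => //; exact: sf.
Qed.

End SmoothCalculus.

Section ChainRule.
Context {R : realType}.

Lemma is_derive_comp_diff {V W : normedModType R} (h : V -> W) (c : R -> V) (t : R) (v : V) :
  differentiable h (c t) -> is_derive t 1 c v -> is_derive t 1 (h \o c) ('D_v h (c t)).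
Proof.
move=> hd [/derivable1_diffP cd <-].
have hcd : differentiable (h \o c) t by exact: differentiable_comp.
split; first exact/derivable1_diffP.
by rewrite !deriveE// diff_comp.
Qed.

Lemma derive_lincomb {V : normedModType R} (h : V -> R) (x : V) (r : nat)
    (a : 'I_r -> R) (v : 'I_r -> V) :
  differentiable h x ->
  'D_(\sum_(i < r) a i *: v i) h x = \sum_(i < r) a i * 'D_(v i) h x.
Proof.
move=> hd; rewrite deriveE// linear_sum; apply: eq_bigr => i _.
by rewrite linearZ deriveE.
Qed.

End ChainRule.

Section FunctionsOnSubmanifold.
Context {R : realType} {n : nat}.
Variable M : set 'rV[R]_n.

Definition local_extension {W : normedModType R} (h : 'rV[R]_n -> W) (x : 'rV[R]_n)
    (A : set 'rV[R]_n) (g : 'rV[R]_n -> W) : Prop :=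
  [/\ open A, A x, smooth_on A g & forall u, M u -> A u -> g u = h u].

Definition locally_smooth {W : normedModType R} (h : 'rV[R]_n -> W) : Prop :=
  forall x, M x -> exists A g, local_extension h x A g.

(* Independent of the local extension g because b x is tangent to M (lieE). *)
Definition lie (b : 'rV[R]_n -> 'rV[R]_n) (h : 'rV[R]_n -> R) (x : 'rV[R]_n) : R :=
  get [set d | exists A g, local_extension h x A g /\ d = 'D_(b x) g x].

Lemma local_extension_differentiable {W : normedModType R} (h g : 'rV[R]_n -> W) A x :
  local_extension h x A g -> forall u, A u -> differentiable g u.
Proof. by move=> [oA Ax sg _] u Au; have [+ _] := sg 1%N; apply. Qed.

Lemma locally_smooth_continuous {W : normedModType R} (h : 'rV[R]_n -> W) :
  locally_smooth h -> {within M, continuous h}.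
Proof.
move=> sh; apply/subspace_continuousP => x Mx.
have [A [g hg]] := sh x Mx; have [oA Ax sg gh] := hg.
have gc : {for x, continuous g}.
  exact/differentiable_continuous/(local_extension_differentiable _ _ _ _ hg).
rewrite [X in _ --> X](_ : _ = g x); last by rewrite gh.
change (h @ within M (nbhs x) --> g x).
apply: cvg_trans (cvg_within_filter _ gc); apply: near_eq_cvg.
rewrite near_withinE; near=> u => Mu; apply: gh => //.
by near: u; exact: open_nbhs_nbhs.
Unshelve. all: by end_near. Qed.

Lemma locally_smoothM (f g : 'rV[R]_n -> R) :
  locally_smooth f -> locally_smooth g -> locally_smooth (f \* g).
Proof.
move=> sf sg x Mx.
have [A [f' [oA Ax sf' ff']]] := sf x Mx; have [B [g' [oB Bx sg' gg']]] := sg x Mx.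
exists (A `&` B), (f' \* g'); split => //; first exact: openI.
  move=> k; apply: Ck_onM; first exact: openI.
    by apply: Ck_on_sub (sf' k) => u [].
  by apply: Ck_on_sub (sg' k) => u [].
by move=> u Mu [Au Bu] /=; rewrite ff'// gg'.
Qed.

Lemma is_derive_on_submanifold (h g : 'rV[R]_n -> R) (x : 'rV[R]_n) A
    (c : R -> 'rV[R]_n) (t : R) v :
  local_extension h x A g -> c t = x -> (\forall s \near t, M (c s)) ->
  is_derive t 1 c v -> is_derive t 1 (h \o c) ('D_v g x).
Proof.
move=> hg ctx Mc cv; have [oA Ax sg gh] := hg.
have cc : {for t, continuous c}.
  by apply/differentiable_continuous/derivable1_diffP; case: cv.
have Ac : \forall s \near t, A (c s).
  by apply: cc; rewrite ctx; exact: open_nbhs_nbhs.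
apply: (@near_eq_is_derive _ _ _ (g \o c)).
  by near=> s; apply: gh; near: s.
rewrite -ctx; apply: is_derive_comp_diff => //.
by apply: (local_extension_differentiable _ _ _ _ hg); rewrite ctx.
Unshelve. all: by end_near. Qed.

(** Along a curve in [M] with velocity [v], both extensions restrict to [h], so their derivatives
    along the curve agree. *)
Lemma derive_tangent_ext (h g1 g2 : 'rV[R]_n -> R) x v A1 A2 :
  tangent_space M x v ->
  local_extension h x A1 g1 -> local_extension h x A2 g2 -> 'D_v g1 x = 'D_v g2 x.
Proof.
move=> [e [c [e_gt0 _ Mc c0 cv]]] hg1 hg2.
have Mc0 : \forall s \near (0 : R), M (c s).
  near=> s; apply: Mc; near: s.
  by apply: open_nbhs_nbhs; split; [exact: interval_open|rewrite /= in_itv/= oppr_lt0 e_gt0].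
have [_ <-] := is_derive_on_submanifold _ _ _ _ _ _ _ hg1 c0 Mc0 cv.
by have [_ <-] := is_derive_on_submanifold _ _ _ _ _ _ _ hg2 c0 Mc0 cv.
Unshelve. all: by end_near. Qed.

Section LieDerivative.
Variable b : 'rV[R]_n -> 'rV[R]_n.
Hypothesis hb : smooth_vector_field M b.

Lemma lieE h g A x : M x -> local_extension h x A g -> lie b h x = 'D_(b x) g x.
Proof.
move=> Mx hg.
have : exists d, exists A g, local_extension h x A g /\ d = 'D_(b x) g x.
  by exists ('D_(b x) g x), A, g.
move=> /getPex[A' [g' [hg' E]]]; rewrite /lie E.
by apply: derive_tangent_ext hg' hg; exact: hb.1.
Qed.

(** The coordinates of an extension of [b], multiplied by the partial derivatives of an extension of
    [h], give a smooth extension of the Lie derivative. Averaging relies on this because it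
    differentiates a Lie derivative once more. *)
Lemma locally_smooth_lie h : locally_smooth h -> locally_smooth (lie b h).
Proof.
move=> sh x Mx; have [A [g hg]] := sh x Mx; have [B [b' [oB Bx sb bb']]] := hb.2 x Mx.
have [oA Ax sg gh] := hg.
have oAB : open (A `&` B) by exact: openI.
exists (A `&` B), (fun u => \sum_(j < n) b' u 0 j * 'D_(delta_mx 0 j) g u); split => //.
  apply: smooth_on_sum => // j k; apply: Ck_onM => //.
    by apply: Ck_on_sub (smooth_on_coord _ _ j oB sb k) => u [].
  apply: (@Ck_on_sub _ _ _ _ A); first by move=> u [].
  by have [_ +] := sg k.+1; apply.
move=> u Mu [Au Bu].
have hgu : local_extension h u A g by split.
rewrite (lieE _ _ _ _ Mu hgu).
rewrite [in RHS](row_sum_delta (b u)) derive_lincomb; last first.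
  exact: (local_extension_differentiable _ _ _ _ hg).
by apply: eq_bigr => j _; rewrite bb'.
Qed.

End LieDerivative.

Lemma is_derive_along_flow (r : nat) (b : 'I_r -> 'rV[R]_n -> 'rV[R]_n) (a : 'I_r -> R)
    (h : 'rV[R]_n -> R) (c : R -> 'rV[R]_n) (t : R) :
  (forall i, smooth_vector_field M (b i)) -> locally_smooth h ->
  (\forall s \near t, M (c s)) -> is_derive t 1 c (\sum_(i < r) a i *: b i (c t)) ->
  is_derive t 1 (h \o c) (\sum_(i < r) a i * lie (b i) h (c t)).
Proof.
move=> hb sh Mc ct; have Mct : M (c t) := nbhs_singleton Mc.
have [A [g hg]] := sh _ Mct.
rewrite (eq_bigr (fun i => a i * 'D_(b i (c t)) g (c t))); last first.
  by move=> i _; rewrite (lieE (b i) (hb i) _ _ _ _ Mct hg).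
rewrite -derive_lincomb; first exact: (is_derive_on_submanifold _ _ _ _ _ _ _ hg erefl Mc ct).
by apply: (local_extension_differentiable _ _ _ _ hg); case: hg.
Qed.

End FunctionsOnSubmanifold.

(** * Averaging by a perturbed Lyapunov function *)

Lemma within_continuous_sub_comp {T U V : topologicalType} (A : set T) (B : set U)
    (f : T -> U) (g : U -> V) :
  (forall x, A x -> B (f x)) -> {within A, continuous f} -> {within B, continuous g} ->
  {within A, continuous (g \o f)}.
Proof.
move=> AB /subspace_continuousP cf /subspace_continuousP cg.
apply/subspace_continuousP => x Ax; apply: cvg_comp; last exact: cg (AB _ Ax).
move=> S /= BS; have := cf x Ax _ BS.
rewrite /= !nbhs_simpl/= /within/= => fS.
near=> y => Ay; apply: (near fS y) => //; exact: AB.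
Unshelve. all: by end_near. Qed.

Lemma compact_within_bounded {R : realType} {T : topologicalType} (K : set T) (f : T -> R) :
  compact K -> {within K, continuous f} -> exists B, forall x, K x -> `|f x| <= B.
Proof.
move=> cK cf; have [B [_ HB]] := compact_bounded (continuous_compact cf cK).
by exists (B + 1) => x Kx; apply: (HB (B + 1)); [rewrite ltrDl|exists x].
Qed.

Section Averaging.
Context {R : realType} {n r : nat}.
Variables (M : set 'rV[R]_n) (b : 'I_r -> 'rV[R]_n -> 'rV[R]_n) (om : 'I_r -> R)
  (kappa : R) (J : 'rV[R]_n -> R).
Hypotheses (Mcompact : compact M) (hb : forall i, smooth_vector_field M (b i))
  (kappa_gt0 : 0 < kappa) (om_gt0 : forall i, 0 < om i)
  (om_inj : forall i j, i != j -> om i != om j) (sJ : locally_smooth M J).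

Let amp i : R := Num.sqrt (2 * om i) * (Num.sqrt kappa)^-1.
Let phase i (x : 'rV[R]_n) (th : R) : R := kappa * J x + om i * th.

(** The flow equation at the single time [t], with [th] standing for tau_2; staying in [M] near [t]
    is what makes Lie derivatives applicable. *)
Definition along_flow (eps t : R) (c : R -> 'rV[R]_n) (th : R -> R) : Prop :=
  [/\ \forall s \near t, M (c s),
      is_derive t 1 c
        (\sum_(i < r) (eps^-1 * (amp i * cos (phase i (c t) (th t)))) *: b i (c t)) &
      is_derive t 1 th (eps ^- 2)].

(* Two-scale derivative: H0 collects the fast part of dH/dt (order eps^-2,
   through th), H1 the slow one (order eps^-1, through x). *)
Definition two_scale_derive (H H0 H1 : 'rV[R]_n -> R -> R) : Prop :=
  forall (eps t : R) c th, 0 < eps -> along_flow eps t c th ->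
  is_derive t 1 (fun s => H (c s) (th s))
    (eps ^- 2 * H0 (c t) (th t) + eps^-1 * H1 (c t) (th t)).

(** Boundedness makes the correction terms and remainders uniformly small in [eps]. Continuity is
    stated along curves because the comparison argument needs it on closed time intervals, where the
    curve is only known to be continuous relative to the interval. *)
Definition regular (H : 'rV[R]_n -> R -> R) : Prop :=
  (exists K : R, forall x th, M x -> `|H x th| <= K) /\
  (forall (S : set R) c th, {within S, continuous c} -> {within S, continuous th} ->
     (forall s, S s -> M (c s)) -> {within S, continuous (fun s => H (c s) (th s))}).

Lemma regular_ext (F G : 'rV[R]_n -> R -> R) : (forall x th, F x th = G x th) ->
  regular F -> regular G.
Proof. by move=> FG; have -> : G = F by apply/funext => x; apply/funext => th. Qed.

Lemma regular_loc_smooth A : locally_smooth M A -> regular (fun x _ => A x).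
Proof.
move=> /locally_smooth_continuous cA; split; last first.
  by move=> S c th cc _ SM; exact: within_continuous_sub_comp cA.
by have [B HB] := compact_within_bounded _ _ Mcompact cA; exists B => x _; exact: HB.
Qed.

Lemma regular_cst (k : R) : regular (fun _ _ => k).
Proof. by split; [by exists (`|k|) |move=> S c th _ _ _ x; exact: cst_continuous]. Qed.

Lemma regularD F G : regular F -> regular G -> regular (fun x th => F x th + G x th).
Proof.
move=> [[K FK] cF] [[L GL] cG]; split.
  by exists (K + L) => x th Mx; rewrite (le_trans (ler_normD _ _))// lerD ?FK ?GL.
move=> S c th cc cth SM x.
exact: cvgD (cF S c th cc cth SM x) (cG S c th cc cth SM x).
Qed.

Lemma regularM F G : regular F -> regular G -> regular (fun x th => F x th * G x th).
Proof.
move=> [[K FK] cF] [[L GL] cG]; split.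
  by exists (K * L) => x th Mx; rewrite normrM ler_pM ?FK ?GL.
move=> S c th cc cth SM x.
exact: cvgM (cF S c th cc cth SM x) (cG S c th cc cth SM x).
Qed.

Lemma regularZ k F : regular F -> regular (fun x th => k * F x th).
Proof. exact/regularM/regular_cst. Qed.

Lemma regular_sum (I : Type) (s : seq I) (F : I -> 'rV[R]_n -> R -> R) :
  (forall i, regular (F i)) -> regular (fun x th => \sum_(i <- s) F i x th).
Proof.
move=> rF; elim: s => [|i s IH].
  by apply: regular_ext (regular_cst 0) => x th; rewrite big_nil.
by apply: regular_ext (regularD _ _ (rF i) IH) => x th; rewrite big_cons.
Qed.

(** [phase i] is the case [ph kappa (om i)]; free coefficients [p] and [o] also cover the sums and
    differences of phases produced by product-to-sum formulas. *)
Let ph (p o : R) (x : 'rV[R]_n) (th : R) := p * J x + o * th.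

Lemma continuous_ph p o (S : set R) c th :
  {within S, continuous c} -> {within S, continuous th} ->
  (forall s, S s -> M (c s)) -> {within S, continuous (fun s => ph p o (c s) (th s))}.
Proof.
move=> cc cth SM x.
have [_ cJ] := regularZ p _ (regular_loc_smooth _ sJ).
by apply: cvgD (cJ S c th cc cth SM x) _; apply: cvgM (cth x); exact: cvg_cst.
Qed.

Lemma regular_sin p o : regular (fun x th => sin (ph p o x th)).
Proof.
split; first by exists 1 => x th _; rewrite ler_norml sin_geN1 sin_le1.
move=> S c th cc cth SM x.
by apply: cvg_comp (continuous_ph p o S c th cc cth SM x) _; exact: continuous_sin.
Qed.

Lemma regular_cos p o : regular (fun x th => cos (ph p o x th)).
Proof.
split; first by exists 1 => x th _; rewrite ler_norml cos_geN1 cos_le1.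
move=> S c th cc cth SM x.
by apply: cvg_comp (continuous_ph p o S c th cc cth SM x) _; exact: continuous_cos.
Qed.

(** By [two_scale_derive_fun], this is [eps] times the derivative of [A] along the flow. *)
Let D A (x : 'rV[R]_n) (th : R) : R :=
  \sum_(i < r) amp i * cos (phase i x th) * lie M (b i) A x.

Lemma regular_D A : locally_smooth M A -> regular (D A).
Proof.
move=> sA; apply: regular_sum => i; apply: regularM.
  by apply: regularZ; exact: (regular_cos kappa (om i)).
by apply: regular_loc_smooth; apply: locally_smooth_lie.
Qed.

Lemma two_scale_derive_ext H H0 H1 G G0 G1 :
  (forall x th, H x th = G x th) -> (forall x th, H0 x th = G0 x th) ->
  (forall x th, H1 x th = G1 x th) ->
  two_scale_derive H H0 H1 -> two_scale_derive G G0 G1.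
Proof.
move=> HG HG0 HG1 dH eps t c th e0 /(dH _ _ _ _ e0); rewrite HG0 HG1.
by under eq_fun do rewrite HG.
Qed.

Lemma two_scale_derive_fun A : locally_smooth M A ->
  two_scale_derive (fun x _ => A x) (fun _ _ => 0) (D A).
Proof.
move=> sA eps t c th e0 [Mc cd _].
have dA := is_derive_along_flow _ _ _ _ _ _ _ hb sA Mc cd.
apply: (is_derive_eq dA); rewrite mulr0 add0r /D mulr_sumr.
by apply: eq_bigr => i _; rewrite /phase; ring.
Qed.

Lemma two_scale_deriveD H H0 H1 G G0 G1 :
  two_scale_derive H H0 H1 -> two_scale_derive G G0 G1 ->
  two_scale_derive (fun x th => H x th + G x th) (fun x th => H0 x th + G0 x th)
    (fun x th => H1 x th + G1 x th).
Proof.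
move=> dH dG eps t c th e0 F.
apply: is_derive_eq; first exact: is_deriveD (dH _ _ _ _ e0 F) (dG _ _ _ _ e0 F).
by ring.
Qed.

Lemma two_scale_deriveM H H0 H1 G G0 G1 :
  two_scale_derive H H0 H1 -> two_scale_derive G G0 G1 ->
  two_scale_derive (fun x th => H x th * G x th)
    (fun x th => H0 x th * G x th + H x th * G0 x th)
    (fun x th => H1 x th * G x th + H x th * G1 x th).
Proof.
move=> dH dG eps t c th e0 F.
apply: is_derive_eq; first exact: is_deriveM (dH _ _ _ _ e0 F) (dG _ _ _ _ e0 F).
by rewrite /GRing.scale/=; ring.
Qed.

Lemma two_scale_derive_cst k : two_scale_derive (fun _ _ => k) (fun _ _ => 0) (fun _ _ => 0).
Proof.
move=> eps t c th e0 F; apply: (is_derive_eq (is_derive_cst k t (1 : R))).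
by rewrite !mulr0 addr0.
Qed.

Lemma two_scale_deriveZ k H H0 H1 : two_scale_derive H H0 H1 ->
  two_scale_derive (fun x th => k * H x th) (fun x th => k * H0 x th) (fun x th => k * H1 x th).
Proof.
move=> dH.
apply: two_scale_derive_ext (two_scale_deriveM _ _ _ _ _ _ (two_scale_derive_cst k) dH)
  => // x th.
  by rewrite mul0r add0r.
by rewrite mul0r add0r.
Qed.

Lemma two_scale_derive_sum (I : Type) (s : seq I) (H H0 H1 : I -> 'rV[R]_n -> R -> R) :
  (forall i, two_scale_derive (H i) (H0 i) (H1 i)) ->
  two_scale_derive (fun x th => \sum_(i <- s) H i x th)
    (fun x th => \sum_(i <- s) H0 i x th) (fun x th => \sum_(i <- s) H1 i x th).
Proof.
move=> dH; elim: s => [|i s IH].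
  by apply: two_scale_derive_ext (two_scale_derive_cst 0) => x th; rewrite big_nil.
by apply: two_scale_derive_ext (two_scale_deriveD _ _ _ _ _ _ (dH i) IH) => x th;
  rewrite big_cons.
Qed.

Lemma two_scale_derive_ph p o :
  two_scale_derive (ph p o) (fun _ _ => o) (fun x th => p * D J x th).
Proof.
have dth : two_scale_derive (fun _ th => th) (fun _ _ => 1) (fun _ _ => 0).
  move=> eps t c th e0 [_ _ thd]; apply: is_derive_eq thd _.
  by rewrite mulr1 mulr0 addr0.
have := two_scale_deriveD _ _ _ _ _ _
  (two_scale_deriveZ p _ _ _ (two_scale_derive_fun _ sJ)) (two_scale_deriveZ o _ _ _ dth).
by apply: two_scale_derive_ext => x th //; rewrite ?mulr0 ?mulr1 ?add0r ?addr0.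
Qed.

Lemma two_scale_derive_sin p o :
  two_scale_derive (fun x th => sin (ph p o x th)) (fun x th => cos (ph p o x th) * o)
    (fun x th => cos (ph p o x th) * (p * D J x th)).
Proof.
move=> eps t c th e0 F; apply: is_derive_eq.
  apply: (@is_derive1_comp _ sin (fun s => ph p o (c s) (th s))).
  exact: two_scale_derive_ph e0 F.
by rewrite /= mulrDr; congr (_ + _); rewrite mulrCA.
Qed.

Lemma two_scale_derive_cos p o :
  two_scale_derive (fun x th => cos (ph p o x th)) (fun x th => - sin (ph p o x th) * o)
    (fun x th => - sin (ph p o x th) * (p * D J x th)).
Proof.
move=> eps t c th e0 F; apply: is_derive_eq.
  apply: (@is_derive1_comp _ cos (fun s => ph p o (c s) (th s))).
  exact: two_scale_derive_ph e0 F.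
by rewrite /= mulrDr; congr (_ + _); rewrite mulrCA.
Qed.

(* F averages to zero: it is, up to O(eps), the derivative of eps^2 H. *)
Definition oscillating (F : 'rV[R]_n -> R -> R) : Prop :=
  exists H Q, [/\ regular H, regular Q & two_scale_derive H F Q].

Lemma oscillating_ext F G : (forall x th, F x th = G x th) -> oscillating F -> oscillating G.
Proof. by move=> FG; have -> : G = F by apply/funext => x; apply/funext => th. Qed.

Lemma oscillatingD F G : oscillating F -> oscillating G ->
  oscillating (fun x th => F x th + G x th).
Proof.
move=> [H [Q [rH rQ dH]]] [H' [Q' [rH' rQ' dH']]].
exists (fun x th => H x th + H' x th), (fun x th => Q x th + Q' x th).
by split; [exact: regularD|exact: regularD|exact: two_scale_deriveD].
Qed.

Lemma oscillatingZ k F : oscillating F -> oscillating (fun x th => k * F x th).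
Proof.
move=> [H [Q [rH rQ dH]]].
exists (fun x th => k * H x th), (fun x th => k * Q x th).
by split; [exact: regularZ|exact: regularZ|exact: two_scale_deriveZ].
Qed.

Lemma oscillating_sum (I : Type) (s : seq I) (F : I -> 'rV[R]_n -> R -> R) :
  (forall i, oscillating (F i)) -> oscillating (fun x th => \sum_(i <- s) F i x th).
Proof.
move=> oF; elim: s => [|i s IH].
  exists (fun _ _ => 0), (fun _ _ => 0); split; [exact: regular_cst|exact: regular_cst|].
  by apply: two_scale_derive_ext (two_scale_derive_cst 0) => // x th; rewrite big_nil.
by apply: oscillating_ext (oscillatingD _ _ (oF i) IH) => x th; rewrite big_cons.
Qed.

(** The fast primitive is [o^-1 * A x * sin (ph p o x th)]: differentiating the sine in [th] gives
    back the term, and all derivatives through [x] are of the slow order. *)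
Lemma oscillating_cos (A : 'rV[R]_n -> R) (p o : R) : locally_smooth M A -> o != 0 ->
  oscillating (fun x th => A x * cos (ph p o x th)).
Proof.
move=> sA o0; have rA := regular_loc_smooth _ sA.
have := two_scale_deriveZ o^-1 _ _ _ (two_scale_deriveM _ _ _ _ _ _
  (two_scale_derive_fun _ sA) (two_scale_derive_sin p o)).
move=> dH; eexists; eexists; split; last first.
- apply: two_scale_derive_ext dH => // x th.
  by rewrite mul0r add0r mulrCA [in RHS]mulrC; field.
- apply: regularZ; apply: regularD; apply: regularM => //.
  + exact: regular_D.
  + exact: regular_sin.
  + by apply: regularM; [exact: regular_cos|apply: regularZ; exact: regular_D].
- by apply: regularZ; apply: regularM => //; exact: regular_sin.
Qed.

Lemma oscillating_sin (A : 'rV[R]_n -> R) (p o : R) : locally_smooth M A -> o != 0 ->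
  oscillating (fun x th => A x * sin (ph p o x th)).
Proof.
move=> sA o0; have rA := regular_loc_smooth _ sA.
have := two_scale_deriveZ (- o^-1) _ _ _ (two_scale_deriveM _ _ _ _ _ _
  (two_scale_derive_fun _ sA) (two_scale_derive_cos p o)).
move=> dH; eexists; eexists; split; last first.
- apply: two_scale_derive_ext dH => // x th.
  by rewrite mul0r add0r; field.
- apply: regularZ; apply: regularD; apply: regularM => //.
  + exact: regular_D.
  + exact: regular_cos.
  + apply: regularM; last by apply: regularZ; exact: regular_D.
    by apply: regular_ext (regularZ (-1) _ (regular_sin p o)) => x th; rewrite mulN1r.
- by apply: regularZ; apply: regularM => //; exact: regular_cos.
Qed.

Let h i : 'rV[R]_n -> R := lie M (b i) J.
Let h2 i j : 'rV[R]_n -> R := lie M (b j) (h i).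

Lemma smooth_h i : locally_smooth M (h i).
Proof. exact: locally_smooth_lie. Qed.

Lemma smooth_h2 i j : locally_smooth M (h2 i j).
Proof. by apply: locally_smooth_lie => //; exact: smooth_h. Qed.

(** The normalization behind the amplitudes of the vector field: since the square of a cosine has
    mean 1/2, each averaged diagonal term becomes exactly the square of [h i]. *)
Lemma amp_sqr i : kappa * (amp i * amp i / om i) = 2.
Proof.
have k0 : kappa != 0 by rewrite gt_eqF.
have o0 : om i != 0 by rewrite gt_eqF.
rewrite /amp mulrACA -invfM -!expr2 !sqr_sqrtr ?(ltW kappa_gt0)//; first by field; apply/andP.
by rewrite mulr_ge0// ltW.
Qed.

Lemma phD p o p' o' x th : ph (p + p') (o + o') x th = ph p o x th + ph p' o' x th.
Proof. by rewrite /ph; ring. Qed.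

Lemma phB p o p' o' x th : ph (p - p') (o - o') x th = ph p o x th - ph p' o' x th.
Proof. by rewrite /ph; ring. Qed.

(** One term of the slow derivative of the first correction, minus its mean. Product-to-sum formulas
    leave only the frequencies [om i + om j], which is positive, and [om i - om j], which vanishes
    only on the diagonal and there produces the mean. *)
Lemma oscillating_pair i j : oscillating (fun x th =>
  amp i * amp j / om i * (h2 i j x * (sin (phase i x th) * cos (phase j x th)) +
    kappa * (h i x * h j x) * (cos (phase i x th) * cos (phase j x th)))
  - (i == j)%:R * (h i x) ^+ 2).
Proof.
have oD : om i + om j != 0 by rewrite gt_eqF// addr_gt0.
have shh : locally_smooth M (h i \* h j) by apply: locally_smoothM; exact: smooth_h.
have oscD := oscillatingD _ _ (oscillating_sin _ (kappa + kappa) _ (smooth_h2 i j) oD)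
  (oscillatingZ kappa _ (oscillating_cos _ (kappa + kappa) _ shh oD)).
(* On the diagonal the difference phase is 0: its sine disappears and its cosine contributes the
   constant evaluated by [amp_sqr]. *)
have [E|ij] := eqVneq i j.
  apply: oscillating_ext (oscillatingZ (amp i * amp j / om i / 2) _ oscD) => x th /=.
  have -> : ph (kappa + kappa) (om i + om j) x th = phase i x th + phase i x th.
    by rewrite -E; exact: phD.
  rewrite -E (sinD (phase i x th)) (cosD (phase i x th)) mul1r.
  have := amp_sqr i; have := cos2Dsin2 (phase i x th).
  move: (sin _) (cos _) (amp i * amp i / om i) (h2 _ _ _) (h i x) => s c a B C sc ka.
  have -> : s * s = 1 - c * c by rewrite -sc; ring.
  have -> : C ^+ 2 = kappa * a / 2 * C ^+ 2 by rewrite ka divff ?mul1r.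
  by field.
(* Distinct frequencies make the difference phase oscillate as well; its [J] coefficient is
   [kappa - kappa], so it depends on [th] alone. *)
have oB : om i - om j != 0 by rewrite subr_eq0 om_inj.
have oscB := oscillatingD _ _ (oscillating_sin _ (kappa - kappa) _ (smooth_h2 i j) oB)
  (oscillatingZ kappa _ (oscillating_cos _ (kappa - kappa) _ shh oB)).
apply: oscillating_ext
  (oscillatingZ (amp i * amp j / om i / 2) _ (oscillatingD _ _ oscD oscB)) => x th /=.
rewrite (phD kappa (om i) kappa (om j)) (phB kappa (om i) kappa (om j)).
rewrite (sinD (ph _ _ _ _)) (cosD (ph _ _ _ _)) (sinB (ph _ _ _ _)) (cosB (ph _ _ _ _)).
rewrite mul0r subr0 -[ph kappa (om i) _ _]/(phase i x th) -[ph kappa (om j) _ _]/(phase j x th).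
move: (sin (phase i _ _)) (sin (phase j _ _)) (cos (phase i _ _)) (cos (phase j _ _)).
move: (amp i * amp j / om i) (h2 _ _ _) (h i x) (h j x) => a A B C s1 s2 c1 c2.
by field.
Qed.

Lemma perturbed_lyapunov : exists (K : R) (P : R -> 'rV[R]_n -> R -> R), 0 <= K /\
  forall eps : R, 0 < eps -> eps <= 1 ->
  [/\ forall x th, M x -> `|P eps x th - J x| <= eps * K,
      regular (P eps) &
      forall t c th, along_flow eps t c th ->
        exists2 d, is_derive t 1 (fun s => P eps (c s) (th s)) d &
          d <= - \sum_(i < r) (h i (c t)) ^+ 2 + eps * K].
Proof.
(* [F1] is a fast primitive of [D J]; [H] is then a fast primitive of the oscillating part of the
   slow derivative of [F1]. *)
pose F1 x th := \sum_(i < r) amp i / om i * (h i x * sin (phase i x th)).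
have [H [Q [rH rQ dH]]] : oscillating (fun x th => \sum_(i < r) \sum_(j < r)
    (amp i * amp j / om i * (h2 i j x * (sin (phase i x th) * cos (phase j x th)) +
      kappa * (h i x * h j x) * (cos (phase i x th) * cos (phase j x th)))
    - (i == j)%:R * (h i x) ^+ 2)).
  by apply: oscillating_sum => i; apply: oscillating_sum => j; exact: oscillating_pair.
have rF1 : regular F1.
  apply: regular_sum => i; apply: regularZ; apply: regularM.
    exact/regular_loc_smooth/smooth_h.
  exact: (regular_sin kappa (om i)).
have dF1 : two_scale_derive F1 (D J) (fun x th => \sum_(i < r) \sum_(j < r)
    (amp i * amp j / om i * (h2 i j x * (sin (phase i x th) * cos (phase j x th)) +
      kappa * (h i x * h j x) * (cos (phase i x th) * cos (phase j x th))))).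
  have := two_scale_derive_sum _ (index_enum 'I_r) _ _ _
    (fun i => two_scale_deriveZ (amp i / om i) _ _ _ (two_scale_deriveM _ _ _ _ _ _
      (two_scale_derive_fun _ (smooth_h i)) (two_scale_derive_sin kappa (om i)))).
  apply: two_scale_derive_ext => x th //.
    apply: eq_bigr => i _; rewrite mul0r add0r -/(phase _ _ _).
    have o0 : om i != 0 by rewrite gt_eqF.
    rewrite -/(h i). move: (cos _) (h i x) (amp i) => C B A. by field.
  apply: eq_bigr => i _; rewrite /D !mulr_sumr mulr_suml -big_split/= mulr_sumr.
  apply: eq_bigr => j _; rewrite -/(h j) -/(h2 i j) -/(phase _ _ _).
  move: (cos _) (cos _) (sin _) (h i x) (h j x) (h2 i j x) => C C' S B B' B2.
  by field; rewrite gt_eqF.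
have [[K1 F1K] _] := rF1; have [[K2 HK] _] := rH; have [[K3 QK] _] := rQ.
(* [K1] and [K2] control the two corrections, the second through [eps ^+ 2 <= eps]; [K3] controls
   the slow derivative of [H], which is the final remainder. *)
pose K : R := `|K1| + `|K2| + `|K3|.
exists K, (fun eps x th => J x + (- eps * F1 x th + eps ^+ 2 * H x th)).
split; first by rewrite !addr_ge0.
move=> eps eps0 eps1; split.
- move=> x th Mx; rewrite addrAC subrr add0r (le_trans (ler_normD _ _))//.
  rewrite !normrM normrN (gtr0_norm eps0).
  have le1 : `|F1 x th| <= `|K1| by rewrite (le_trans (F1K _ _ Mx))// ler_norm.
  have le2 : `|H x th| <= `|K2| by rewrite (le_trans (HK _ _ Mx))// ler_norm.
  have : eps * (eps * `|H x th|) <= eps * (1 * `|K2|).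
    by rewrite ler_pM2l// ler_pM// ltW.
  have : eps * `|F1 x th| <= eps * `|K1| by rewrite ler_pM2l.
  have : 0 <= eps * `|K3| by rewrite mulr_ge0// ltW.
  rewrite /K. lra.
- apply: regularD; first exact: regular_loc_smooth.
  by apply: regularD; apply: regularZ.
- move=> t c th F.
  have := two_scale_deriveD _ _ _ _ _ _ (two_scale_derive_fun _ sJ)
    (two_scale_deriveD _ _ _ _ _ _ (two_scale_deriveZ (- eps) _ _ _ dF1)
      (two_scale_deriveZ (eps ^+ 2) _ _ _ dH)) _ _ _ _ eps0 F.
  move=> dP; eexists; first exact: dP.
  have Mc : M (c t) by case: F => /nbhs_singleton.
  have le3 : Q (c t) (th t) <= `|K3|.
    by rewrite (le_trans (ler_norm _))// (le_trans (QK _ _ Mc))// ler_norm.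

  under [X in eps ^+ 2 * X]eq_bigr do rewrite sumrB.
  rewrite sumrB.
  have -> : \sum_(i < r) \sum_(j < r) (i == j)%:R * h i (c t) ^+ 2 = \sum_(i < r) h i (c t) ^+ 2.
    apply: eq_bigr => i _; rewrite -mulr_suml (bigD1 i)//= eqxx big1 ?addr0 ?mul1r// => j.
    by rewrite eq_sym => /negbTE->.
  move: le3; move: (D _ _ _) (Q _ _) (\sum_(i < r) h i _ ^+ 2) (\sum_(i < r) _) => d q X S qK.
  (* The terms in [d] cancel, and so do the two copies of [S]; the mean [- X] and the remainder
     [eps * q] survive. *)
  have -> : eps ^- 2 * (0 + (- eps * d + eps ^+ 2 * (S - X))) +
      eps^-1 * (d + (- eps * S + eps ^+ 2 * q)) = - X + eps * q.
    by field; rewrite gt_eqF.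
  rewrite lerD2l ler_pM2l// (le_trans qK)// /K lerDr addr_ge0//.
Qed.

End Averaging.

(** * Comparison and class KL bounds *)

Section ComparisonAndKL.
Context {R : realType}.

(** If [f] ends above [rho], it can never have been at or below [rho]: after the last such time it
    would be nonincreasing. The mean value theorem then gives the full decrease over the
    interval. *)
Lemma decrease_above_level (f : R -> R) (rho a t0 t1 : R) :
  0 <= a -> t0 <= t1 -> {within `[t0, t1], continuous f} ->
  (forall t, t0 < t < t1 -> exists2 d, is_derive t 1 f d & (rho <= f t -> d <= - a)) ->
  f t1 <= Num.max rho (f t0 - a * (t1 - t0)).
Proof.
move=> a_ge0 t01 cf df.
have mean s : t0 <= s -> s < t1 -> (forall u, s < u < t1 -> rho <= f u) ->
    f t1 <= f s - a * (t1 - s).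
  move=> t0s st1 above.
  have [||c] := @MVT _ f (fun u => 'D_1 f u) s t1 st1.
  - move=> u; rewrite in_itv/= => /andP[su ut].
    have [|d fd _] := df u; first by rewrite ut (le_lt_trans t0s).
    by apply: derivableP; case: fd.
  - apply: continuous_subspaceW cf => u /=; rewrite !in_itv/= => /andP[su ->].
    by rewrite (le_trans t0s).
  rewrite in_itv/= => sct E.
  have [|d [_ cd] da] := df c.
    by have [sc ->] := andP sct; rewrite (le_lt_trans t0s).
  have := da (above _ sct); rewrite -cd => dle.
  suff : 'D_1 f c * (t1 - s) <= - a * (t1 - s) by rewrite -E; lra.
  by rewrite ler_wpM2r// subr_ge0 ltW.
have [lowt1|hight1] := leP (f t1) rho; first by rewrite le_max lowt1.
(* The supremum of [S] is the last time at which [f <= rho]; continuity keeps the inequality at the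
   supremum itself. *)
pose S := [set s | t0 <= s <= t1 /\ f s <= rho].
have [[s0 Ss0]|S0] := pselect (S !=set0); last first.
  have [->|t0t1] := eqVneq t0 t1; first by rewrite subrr mulr0 subr0 le_max lexx orbT.
  rewrite le_max mean ?orbT// ?lt_neqAle ?t0t1// => u /andP[t0u ut1].
  by rewrite leNgt; apply/negP => fu; apply: S0; exists u; split; rewrite ?ltW.
have supS : has_sup S by split; [exists s0|exists t1 => s [/andP[]]].
pose s := sup S.
have st : t0 <= s <= t1.
  rewrite (le_trans _ (sup_upper_bound supS Ss0))/=; last by case: Ss0 => /andP[].
  by apply: ge_sup; [exists s0|move=> u [/andP[]]].
have fs : f s <= rho.
  rewrite leNgt; apply/negP => fs.
  have /subspace_continuousP/(_ s) := cf; rewrite /= in_itv/= => /(_ st).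
  move=> /cvgrPdist_lt/(_ (f s - rho)); rewrite subr_gt0 => /(_ fs).
  rewrite near_withinE => /nbhs_ballP[d /= d_gt0 fd].
  have [u Su su] := sup_adherent d_gt0 supS.
  have us : u <= s by exact: sup_upper_bound.
  have su' : s - u < d by rewrite -/s in su; lra.
  have [+ fu] := Su; have := fd u; rewrite /ball/= in_itv/= ger0_norm ?subr_ge0// => /(_ su').
  move=> /[apply]; change (`|f s - f u| < f s - rho -> False).
  by have := ler_norm (f s - f u); lra.
have st1 : s < t1.
  rewrite lt_neqAle (andP st).2 andbT; apply/eqP => E.
  by move: fs; rewrite E leNgt hight1.
have := mean s (andP st).1 st1.
have above u : s < u < t1 -> rho <= f u.
  move=> /andP[su ut]; rewrite leNgt; apply/negP => fu.
  have /(sup_upper_bound supS) : S u.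
    by split; [rewrite (le_trans (andP st).1 (ltW su)) ltW|exact: ltW].
  by rewrite leNgt su.
move=> /(_ above); have : 0 <= a * (t1 - s) by rewrite mulr_ge0// subr_ge0 ltW.
lra.
Qed.

(** A compactness principle used three times: for the dissipation bound, and for comparing [Jt q]
    with the distance to [xs] in both directions. The threshold [rho] is handled as a parameter
    tending to 0 from the right, uniformly over a cover of [K]. *)
Lemma compact_dominance {T : topologicalType} (K : set T) (f g : T -> R) :
  compact K -> {within K, continuous f} -> {within K, continuous g} ->
  (forall x, K x -> f x <= 0 -> g x <= 0) ->
  forall nu : R, 0 < nu -> exists2 rho : R, 0 < rho &
    forall x, K x -> f x < rho -> g x < nu.
Proof.
move=> /compact_near_coveringP cK /subspace_continuousP cf /subspace_continuousP cg fg nu nu0.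
have : \forall rho \near (0 : R)^'+, K `<=` (fun x => K x -> f x < rho -> g x < nu).
  (* Near a point with [f x <= 0] the conclusion on [g] holds by continuity; near any other point
     [f] exceeds [f x / 2], so smaller values of [rho] make the premise false. *)
  apply: cK => x Kx; have [fx|fx] := leP (f x) 0.
    have gx : g x < nu by exact: le_lt_trans (fg _ Kx fx) nu0.
    have /cvgr_lt/(_ _ gx) := cg _ Kx; rewrite near_withinE => H.
    exists (fun y => K y -> g y < nu, setT) => /=; first by split => //; exact: filterT.
    by move=> [y rho] /= [gy _] Ky _; exact: gy.
  have fx2 : f x / 2 < f x by lra.
  have /cvgr_gt/(_ _ fx2) := cf _ Kx; rewrite near_withinE => H.
  exists (fun y => K y -> f x / 2 < f y, [set rho | rho < f x / 2]) => /=.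
    by split => //; apply: nbhs_right_lt; rewrite divr_gt0.
  move=> [y rho] /= [fy rfx] Ky fyr; have := fy Ky; lra.
move=> H; have {}H : \forall rho \near (0 : R)^'+, forall x, K x -> f x < rho -> g x < nu.
  by apply: filterS H => rho Krho x Kx; exact: Krho.
near (0 : R)^'+ => rho; exists rho; first by near: rho; exact: nbhs_right_gt.
by near: rho.
Unshelve. all: by end_near. Qed.

Lemma finite_pos_lower_bound (f : nat -> R) (K : nat) :
  (forall k, 0 < f k) -> exists2 e, 0 < e & forall k, (k < K)%N -> e <= f k.
Proof.
move=> f0; elim: K => [|K [e e0 IH]]; first by exists 1.
exists (Num.min e (f K)); first by rewrite lt_min e0 f0.
by move=> k; rewrite ltnS leq_eqVlt => /predU1P[->|/IH ek]; rewrite ge_min ?lexx ?orbT ?ek.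
Qed.

Lemma finite_upper_bound (f : nat -> R) (K : nat) :
  exists e, forall k, (k < K)%N -> f k <= e.
Proof.
elim: K => [|K [e IH]]; first by exists 0.
exists (Num.max e (f K)).
by move=> k; rewrite ltnS leq_eqVlt => /predU1P[->|/IH ek]; rewrite le_max ?lexx ?orbT ?ek.
Qed.

(* S eps r s d reads: at parameter eps, some trajectory starting at distance r is
   at distance d after hybrid time s. *)
Lemma KL_bound (S : R -> R -> R -> R -> Prop) (D : R) :
  0 <= D -> (forall eps r s d, S eps r s d -> [/\ 0 <= r, 0 <= s & d <= D]) ->
  (forall nu, 0 < nu -> exists eta T eps0 : R, [/\ 0 < eta, 0 < eps0 &
    forall eps r s d, 0 < eps -> eps <= eps0 -> S eps r s d ->
      r <= eta \/ T <= s -> d <= nu]) ->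
  exists2 beta : R -> R -> R, class_KL beta &
    forall nu, 0 < nu -> exists2 eps0, 0 < eps0 &
      forall eps, 0 < eps -> eps <= eps0 ->
      forall r s d, S eps r s d -> d <= beta r s + nu.
Proof.
move=> D0 SD Snu.
(* Target accuracies: the a priori bound first, then a sequence tending to 0. The triple [p k] below
   consists of the radius, time and parameter threshold that guarantee the next accuracy
   [u k.+1]. *)
pose u (k : nat) : R := if k is 0 then D else k%:R^-1.
have u_ge0 k : 0 <= u k by case: k => //= k; rewrite invr_ge0.
have /choice[p Hp] (k : nat) : exists p : R * R * R, [/\ 0 < p.1.1, 0 < p.2 &
    forall eps r s d, 0 < eps -> eps <= p.2 -> S eps r s d ->
      r <= p.1.1 \/ p.1.2 <= s -> d <= u k.+1].
  by have [|eta [T [eps0 H]]] := Snu (u k.+1); [rewrite /= invr_gt0|exists (eta, T, eps0)].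
(* Level [k] is active when neither the starting radius nor the elapsed time yet guarantees
   [u k.+1]; [beta] is the supremum of [u] over active levels, with 0 added to keep the set
   nonempty. *)
pose active r s k := (p k).1.1 < r /\ s < (p k).1.2.
pose B r s := [set x | x = 0 \/ exists2 k, active r s k & x = u k].
have ubB r s : has_sup (B r s).
  split; first by exists 0; left.
  exists (D + 1) => x [->|[k _ ->]]; first by rewrite addr_ge0.
  case: k => [|k] /=; first by rewrite lerDl.
  by rewrite -[leLHS]add0r lerD// invf_le1// ler1n.
pose beta r s := sup (B r s).
have beta_ge r s k : active r s k -> u k <= beta r s.
  by move=> rsk; apply: sup_upper_bound => //; right; exists k.
have beta_ge0 r s : 0 <= beta r s by apply: sup_upper_bound => //; left.
have beta_le r s c : 0 <= c -> (forall k, active r s k -> u k <= c) -> beta r s <= c.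
  by move=> c0 uc; apply: ge_sup; [exists 0; left|move=> x [->//|[k /uc + ->]]].
have u_small nu : 0 < nu -> exists K, forall k, (K <= k)%N -> u k <= nu.
  move=> nu0; exists (Num.truncn nu^-1).+1 => -[//|k] Kk /=.
  rewrite -[nu]invrK lef_pV2 ?posrE ?invr_gt0//.
  by rewrite (le_trans (ltW (truncnS_gt _)))// ler_nat.
exists beta.
  split => //.
  - move=> r1 r2 s _ r12 _; apply: beta_le => // k [r1k sk]; apply: beta_ge.
    by split => //; exact: lt_le_trans r12.
  - move=> r s1 s2 _ _ s12; apply: beta_le => // k [rk s2k]; apply: beta_ge.
    by split => //; exact: le_lt_trans s2k.
  - move=> s _; apply/cvgrPdist_le => nu nu0.
    (* For [r] below the first [K] radii, only levels from [K] on can be active, and these have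
       [u k <= nu]. The limit in [s] below uses the first [K] times in the same way. *)
    have [K uK] := u_small _ nu0.
    have [e e0 eK] := finite_pos_lower_bound (fun k => (p k).1.1) K
      (fun k => let: And3 h _ _ := Hp k in h).
    near=> r.
    have re : r < e by near: r; exact: nbhs_right_lt.
    rewrite sub0r normrN ger0_norm//; apply: beta_le => [|k [rk _]]; first exact: ltW.
    by apply: uK; rewrite leqNgt; apply/negP => /eK; rewrite leNgt (lt_trans rk re).
  - move=> r _; apply/cvgrPdist_le => nu nu0.
    have [K uK] := u_small _ nu0.
    have [T TK] := finite_upper_bound (fun k => (p k).1.2) K.
    near=> s.
    have sT : T <= s by near: s; apply: nbhs_pinfty_ge; rewrite num_real.
    rewrite sub0r normrN ger0_norm//; apply: beta_le => [|k [_ sk]]; first exact: ltW.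
    by apply: uK; rewrite leqNgt; apply/negP => /TK; rewrite leNgt (le_lt_trans sT sk).
move=> nu nu0; have [K uK] := u_small _ nu0.
(* Accuracy [nu] involves finitely many levels, so one threshold on [eps] serves all of them. *)
have [eps0 e0 eK] := finite_pos_lower_bound (fun k => (p k).2) K.+1
  (fun k => let: And3 _ h _ := Hp k in h).
exists eps0 => // eps eps_gt0 eps_le r s d Srsd; have [r0 s0 dD] := SD _ _ _ _ Srsd.
have inactive k : (k <= K)%N -> ~ active r s k -> d <= u k.+1.
  move=> kK nak; have [_ _ Hk] := Hp k.
  apply: (Hk _ _ _ _ eps_gt0 (le_trans eps_le (eK k kK)) Srsd).
  have [rk|rk] := leP r (p k).1.1; first by left.
  by right; rewrite leNgt; apply/negP => sk; apply: nak.
(* Going up the levels, an active one converts the bound [u k] into [beta], and an inactive one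
   improves it to [u k.+1]. *)
have all_active k : (k <= K.+1)%N -> d <= u k \/ d <= beta r s.
  elim: k => [|k IH] kK; first by left.
  have [ak|nak] := pselect (active r s k).
    have [dk|] := IH (ltnW kK); last by right.
    by right; rewrite (le_trans dk)// beta_ge.
  by left; exact: inactive.
have [dK|dbeta] := all_active K.+1 (leqnn _).
  by rewrite (le_trans dK)// (le_trans (uK K.+1 _))// ler_wpDl.
by rewrite (le_trans dbeta)// lerDl ltW.
Unshelve. all: by end_near. Qed.

End ComparisonAndKL.

(** * Hybrid arcs *)

Section HybridGeneralities.
Context {R : realType}.

(** Covers the coordinate projections of the product state, through which derivatives and absolute
    continuity pass to the components. *)
Definition linear_contraction {E F : normedModType R} (pi : E -> F) : Prop :=
  [/\ forall u v, pi (u - v) = pi u - pi v, forall (k : R) u, pi (k *: u) = k *: pi u &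
      forall u, `|pi u| <= `|u|].

Lemma linear_contraction_fst {E F : normedModType R} : linear_contraction (@fst E F).
Proof. by split => // u; rewrite prod_normE le_max lexx. Qed.

Lemma linear_contraction_snd {E F : normedModType R} : linear_contraction (@snd E F).
Proof. by split => // u; rewrite prod_normE le_max lexx orbT. Qed.

Lemma linear_contraction_comp {E F G : normedModType R} (pi : E -> F) (pi' : F -> G) :
  linear_contraction pi -> linear_contraction pi' -> linear_contraction (pi' \o pi).
Proof.
move=> [B Z L] [B' Z' L']; split => [u v|k u|u] /=; first by rewrite B B'.
  by rewrite Z Z'.
exact: le_trans (L' _) (L _).
Qed.

Lemma is_derive_contraction {E F : normedModType R} (pi : E -> F) (f : R -> E) (t : R) (v : E) :
  linear_contraction pi -> is_derive t 1 f v -> is_derive t 1 (pi \o f) (pi v).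
Proof.
move=> [B Z L] fv; apply: near_expansion_is_derive => e e0.
apply: filterS (is_derive_near_expansion _ _ _ _ e0 fv) => s; apply: le_trans.
by rewrite /= -Z -!B.
Qed.

Lemma abs_continuous_contraction {E F : normedModType R} (pi : E -> F) (f : R -> E) (a b : R) :
  linear_contraction pi -> abs_continuous a b f -> abs_continuous a b (pi \o f).
Proof.
move=> [B _ L] fac e /fac[d d0 fd]; exists d => // m u v uv tI lt_d.
apply: le_lt_trans (fd m u v uv tI lt_d); apply: ler_sum => k _.
by rewrite /= -B.
Qed.

(** Truncated at [(t, j)], the domain is a finite alternation of intervals and jumps. Induction on
    the jump index reaches the start of the last interval, and one more flow step reaches [t]. *)
Lemma hybrid_induction (dom : set (R * nat)) (G : R -> nat -> Prop) :
  hybrid_time_domain dom -> G 0 0%N ->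
  (forall j t0 t1, t0 <= t1 -> (forall s, t0 <= s <= t1 -> dom (s, j)) ->
     G t0 j -> G t1 j) ->
  (forall t j, dom (t, j) -> dom (t, j.+1) -> G t j -> G t j.+1) ->
  forall t j, dom (t, j) -> G t j.
Proof.
move=> [dom0 domc] G0 Gflow Gjump t j domtj.
have [m [u [u0 u_le domE]]] := domc _ _ domtj.
have domP s k : (k < m)%N -> u k <= s <= u k.+1 -> dom (s, k).
  move=> km usu.
  have : [set p : R * nat | (p.2 < m)%N /\ u p.2 <= p.1 <= u p.2.+1] (s, k) by [].
  by rewrite -domE => -[].
have : [set p : R * nat | (p.2 < m)%N /\ u p.2 <= p.1 <= u p.2.+1] (t, j).
  by rewrite -domE; split => //=; rewrite lexx (dom0 _ domtj) leqnn.
move=> /= [jm /andP[ujt tuj]].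
have Gu k : (k < m)%N -> G (u k) k.
  elim: k => [|k IH] km; first by rewrite u0.
  have km' : (k < m)%N by exact: ltnW.
  have Gk : G (u k.+1) k.
    by apply: (Gflow k (u k)); [exact: u_le|move=> s; exact: domP|exact: IH].
  by apply: Gjump => //; apply: domP; rewrite // lexx u_le.
apply: (Gflow j (u j)) => //; last exact: Gu.
by move=> s /andP[us st]; apply: domP => //; rewrite us (le_trans st).
Qed.

End HybridGeneralities.

(** * Uniform constants over a finite index set *)

Section FiniteFamilies.
Context {R : realType}.

Lemma finite_choice_antitone (m : nat) (P : 'I_m -> R -> Prop) :
  (forall i x y, x <= y -> P i y -> P i x) -> (forall i, exists2 x, 0 < x & P i x) ->
  exists2 x, 0 < x & forall i, P i x.
Proof.
move=> Pa Pi; have /choice[f Pf] i : exists x, 0 < x /\ P i x.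
  by have [x] := Pi i; exists x.
have f0 i : 0 < f i by case: (Pf i).
exists (\big[Num.min/1]_(i < m) f i).
  by apply: (big_ind (fun x => 0 < x)) => // x y x0 y0; rewrite lt_min x0.
move=> i; apply: (Pa _ _ (f i)); first exact: bigmin_le.
by case: (Pf i).
Qed.

Lemma finite_choice_monotone (m : nat) (P : 'I_m -> R -> Prop) :
  (forall i x y, x <= y -> P i x -> P i y) -> (forall i, exists x, P i x) ->
  exists2 x, 0 <= x & forall i, P i x.
Proof.
move=> Pm /choice[f Pf].
exists (\big[Num.max/0]_(i < m) f i); first exact: bigmax_ge_id.
move=> i; apply: (Pm _ (f i)); first exact: le_bigmax.
exact: Pf.
Qed.

End FiniteFamilies.

(** * Euclidean distance to the attractor *)

Section EuclideanDistance.
Context {R : realType} {n : nat}.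
Implicit Types (x y : 'rV[R]_n).

Definition enorm x : R := Num.sqrt (dotv x x).

Lemma dotv_ge0 x : 0 <= dotv x x.
Proof. by apply: sumr_ge0 => i _; rewrite -expr2 sqr_ge0. Qed.

Lemma dotv_eq0 x : dotv x x = 0 -> x = 0.
Proof.
move=> /eqP; rewrite psumr_eq0; last by move=> i _; rewrite -expr2 sqr_ge0.
move=> /allP x0; apply/rowP => i; rewrite mxE; apply/eqP.
by have := x0 i (mem_index_enum i); rewrite mulf_eq0 orbb.
Qed.

Lemma continuous_enormB y : continuous (fun x => enorm (x - y)).
Proof.
move=> x; apply: (@continuous_comp _ _ _ (fun x => dotv (x - y) (x - y)) Num.sqrt);
  last exact: sqrt_continuous.
apply: (@cvg_big _ _ +%R 0 xpredT _ _ (nbhs x) _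
  (fun i (u : 'rV[R]_n) => (u - y) 0 i * (u - y) 0 i)) => [|i _].
  exact: add_continuous.
have ci : (u - y) 0 i @[u --> x] --> (x - y) 0 i.
  rewrite [X in _ --> X]mxE; under eq_fun do rewrite mxE.
  have cx : u 0 i @[u --> x] --> x 0 i by exact: coord_continuous.
  have cy : (- y) 0 i @[_ --> x] --> (- y) 0 i by exact: cst_continuous.
  exact: (@cvgD _ _ _ (nbhs x) _ _ _ _ _ cx cy).
exact: cvgM.
Qed.

(** The attractor contains a point with the same logic coordinate, so only the [x] component
    contributes to the distance. *)
Lemma dist_es_attractor N (xs x : 'rV[R]_n) (q : 'I_N.+1) :
  dist_set (es_attractor N xs) (x, label q) = enorm (x - xs).
Proof.
have inA : [set Num.sqrt (dotv (x - a.1) (x - a.1) + (label q - a.2) ^+ 2)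
    | a in es_attractor N xs] (enorm (x - xs)).
  exists (xs, label q); first by split => //=; exists q.
  by rewrite /= subrr expr0n addr0.
apply/le_anti/andP; split.
  by apply: ge_inf inA; exists 0 => _ [a _ <-]; exact: sqrtr_ge0.
apply: lb_le_inf; first by exists (enorm (x - xs)).
move=> _ [[_ z] [/= -> _] <-].
by rewrite ler_wsqrtr// lerDl sqr_ge0.
Qed.

Lemma label_inj N : injective (@label R N).
Proof. by move=> q q' /eqP; rewrite eqr_nat => /eqP[] /val_inj. Qed.

End EuclideanDistance.

(** * Stability of the extremum seeking system *)

Section ExtremumSeekingStability.
Context {R : realType} {n r N : nat}.
Variables (M U : set 'rV[R]_n) (J : 'rV[R]_n -> R) (xs : 'rV[R]_n) (Jbar : R)
  (b : 'I_r -> 'rV[R]_n -> 'rV[R]_n) (w : 'I_r -> rat)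
  (Jt : 'I_N.+1 -> 'rV[R]_n -> R) (delta kappa : R).
Hypotheses (kappa_gt0 : 0 < kappa) (w_gt0 : forall i, 0 < w i)
  (w_inj : forall i j, i <> j -> w i <> w j) (Mcompact : compact M)
  (oU : open U) (MU : M `<=` U) (Jbar_gt0 : 0 < Jbar) (Mxs : M xs)
  (hb : forall i, smooth_vector_field M (b i))
  (hP : forall x v, M x ->
     (\sum_(i < r) dotv (b i x) v *: b i x = 0 <->
      forall u, tangent_space M x u -> dotv v u = 0))
  (hsyn : synergistic_family M U J xs Jbar delta Jt).

Let om i : R := ratr (w i).

Lemma om_gt0 i : 0 < om i. Proof. by rewrite ltr0q. Qed.

Lemma om_inj i j : i != j -> om i != om j.
Proof. by move=> /eqP ij; apply/eqP => /fmorph_inj; exact: w_inj. Qed.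

Lemma delta_gt0 : 0 < delta. Proof. by case: hsyn. Qed.

Lemma Jt_extension q x : M x -> local_extension M (Jt q) x U (Jt q).
Proof. by move=> Mx; case: hsyn => /(_ q)[sq _ _] _ _ _; split => //; exact: MU. Qed.

Lemma smooth_Jt q : locally_smooth M (Jt q).
Proof. by move=> x Mx; exists U, (Jt q); exact: Jt_extension. Qed.

Lemma Jt_xs q : Jt q xs = J xs.
Proof. by case: hsyn => _ + _ _; apply => //; rewrite ltrDr. Qed.

Lemma Jt_le_eq q x : M x -> Jt q x <= J xs -> x = xs.
Proof.
move=> Mx; case: hsyn => /(_ q)[_ [_ m] _] _ _ _ Jx; apply: contrapT => xxs.
by have := m _ Mx xxs; rewrite Jt_xs ltNge Jx.
Qed.

Lemma minQ_le (f : 'I_N.+1 -> R) q : minQ f <= f q.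
Proof. exact: bigmin_le. Qed.

(** On [M], by [lie_gradient], this is the quadratic form of the operator [P(x)] evaluated at the
    Euclidean gradient of [Jt q]. *)
Definition dissipation q x : R := \sum_(i < r) (lie M (b i) (Jt q) x) ^+ 2.

Lemma dissipation_ge0 q x : 0 <= dissipation q x.
Proof. by apply: sumr_ge0 => i _; exact: sqr_ge0. Qed.

Lemma lie_gradient q i x : M x -> lie M (b i) (Jt q) x = dotv (b i x) (gradient (Jt q) x).
Proof.
move=> Mx; have ext := Jt_extension q x Mx.
rewrite (lieE _ _ (hb i) _ _ _ _ Mx ext) [in LHS](row_sum_delta (b i x)).
rewrite derive_lincomb; last first.
  by apply: (local_extension_differentiable _ _ _ _ _ ext); exact: MU.
by apply: eq_bigr => j _; rewrite mxE.
Qed.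

(** A vanishing sum of squares makes the gradient orthogonal to every [b i x], so [P(x)] kills it
    and hypothesis (3) makes it normal to [M]; its tangential projection is then 0. *)
Lemma crit_dissipation0 q x : M x -> dissipation q x <= 0 -> crit M (Jt q) x.
Proof.
move=> Mx phi0; split => //.
have bg0 i : dotv (b i x) (gradient (Jt q) x) = 0.
  have /eqP : dissipation q x = 0 by apply/le_anti; rewrite phi0 dissipation_ge0.
  rewrite psumr_eq0; last by move=> k _; exact: sqr_ge0.
  move=> /allP/(_ i (mem_index_enum i)); rewrite sqrf_eq0 => /eqP.
  by rewrite lie_gradient.
have gT : forall u, tangent_space M x u -> dotv (gradient (Jt q) x) u = 0.
  by apply/hP => //; apply: big1 => i _; rewrite bg0 scale0r.
have T0 : tangent_space M x 0.
  exists 1, (fun=> x); split => //; last exact: is_derive_cst.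
  move=> k; elim: k x {Mx phi0 bg0 gT} => [|k IH] x; first by move=> t _; exact: cst_continuous.
  split => [t _|v]; first exact: differentiable_cst.
  have -> : (fun t => 'D_v (fun=> x) t) = (fun=> 0 : 'rV[R]_n) :> (R -> 'rV[R]_n).
    by apply/funext => t; exact: derive_cst.
  exact: IH.
(* The candidate 0 shows that a projection exists; the chosen [p] is tangent, hence orthogonal to
   both the gradient and the residual, so [dotv p p = 0]. *)
rewrite /riem_gradient /orth_proj; set S := [set p | _].
have : S !=set0 by exists 0; split => // v Tv; rewrite subr0; exact: gT.
move=> /getPex[/[dup] Tp /gT gp /(_ _ Tp)] E; apply: dotv_eq0.
move: E gp; set p := get S => E gp.
have : dotv (gradient (Jt q) x) p - dotv (gradient (Jt q) x - p) p = dotv p p.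
  by rewrite /dotv -sumrB; apply: eq_bigr => i _; rewrite !mxE; ring.
by rewrite E gp subr0.
Qed.

(** Otherwise the maximum at this critical point would be at most [delta], and so would the gap. The
    consequence is that critical points other than [xs] lie outside the flow set. *)
Lemma crit_gap q x : crit M (Jt q) x -> x <> xs -> exists q', delta < Jt q x - Jt q' x.
Proof.
move=> cx xxs; apply: contrapT => H.
have [_ _ _] := hsyn; apply/negP; rewrite -leNgt.
apply: (@le_trans _ _ (maxQ (fun q2 => Jt q x - Jt q2 x))%:E).
  by apply: ereal_inf_lbound; exists q, x.
rewrite lee_fin; have le q' : Jt q x - Jt q' x <= delta.
  by rewrite leNgt; apply/negP => lt; apply: H; exists q'.
by apply: bigmax_le.
Qed.

(** The flow-set constraint enters as a penalty, twice the positive part of its violation, so that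
    [compact_dominance] applies on all of [M]. Where dissipation and penalty both vanish, [crit_gap]
    leaves only [xs], at which [Jt q] equals [J xs]. *)
Lemma dissipation_lower_bound q (rho : R) : 0 < rho ->
  exists2 c, 0 < c & forall x, M x -> Jt q x - minQ (Jt ^~ x) <= delta ->
    rho <= Jt q x - J xs -> c <= dissipation q x.
Proof.
move=> rho_gt0.
(* f vanishes exactly at the zeros of the dissipation lying in the flow set. *)
pose excess (u : R) := u + `|u|.
have excess_ge0 u : 0 <= excess u by rewrite /excess -lerBlDl sub0r -normrN ler_norm.
have excess_le0 u : excess u <= 0 -> u <= 0.
  by rewrite /excess => ?; have := normr_ge0 u; lra.
pose f x := dissipation q x + \sum_(q' < N.+1) excess (Jt q x - Jt q' x - delta).
have cJ q' : {within M, continuous (Jt q')} := locally_smooth_continuous _ _ (smooth_Jt q').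
have [||x Mx fx|c c0 Hc] :=
  compact_dominance M f (fun x => Jt q x - J xs) Mcompact _ _ _ _ rho_gt0.
- move=> x; apply: cvgD.
    apply: cvg_big => [|i _]; first exact: add_continuous.
    have ci := locally_smooth_continuous _ _ (locally_smooth_lie _ _ (hb i) _ (smooth_Jt q)) x.
    exact: (cvgM ci ci).
  apply: cvg_big => [|q' _]; first exact: add_continuous.
  have cu : {for x, continuous (fun x : subspace M => Jt q x - Jt q' x - delta)}.
    apply: cvgB; last exact: cvg_cst.
    exact: cvgB (cJ q x) (cJ q' x).
  by apply: cvgD => //; exact: cvg_norm.
- by move=> x; apply: cvgB; [exact: (cJ q x)|exact: cvg_cst].
- have := fx; rewrite /f => fx0.
  have sum_ge0 : 0 <= \sum_(q' < N.+1) excess (Jt q x - Jt q' x - delta).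
    by apply: sumr_ge0 => q' _.
  have diss0 := dissipation_ge0 q x.
  have [->|xxs] := eqVneq x xs; first by rewrite Jt_xs subrr.
  have cx : crit M (Jt q) x by apply: crit_dissipation0 => //; lra.
  have [q' gap] := crit_gap q x cx (elimN eqP xxs).
  have : excess (Jt q x - Jt q' x - delta) <= 0.
    apply: (@le_trans _ _ (\sum_(q' < N.+1) excess (Jt q x - Jt q' x - delta))); last lra.
    by rewrite (bigD1 q')//= lerDl sumr_ge0.
  by move=> /excess_le0; lra.
(* By contraposition; in the flow set the penalty is zero and [f] reduces to the dissipation. *)
exists c => // x Mx xC; apply: contraTle => fc; rewrite -ltNge; apply: Hc => //.
rewrite /f big1 ?addr0// => q' _; rewrite /excess ler0_norm ?subrr//.
by have := minQ_le (Jt ^~ x) q'; lra.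
Qed.

Let sys eps := es_system M b w kappa delta Jt eps.

(** Translates a solution on a nondegenerate flow interval into the setting of averaging: a fixed
    mode, and the flow equation at every interior time. *)
Lemma sys_flow_interval eps dom y j t0 t1 :
  hds_solution (sys eps) dom y -> t0 < t1 -> (forall s, t0 <= s <= t1 -> dom (s, j)) ->
  exists q, [/\
    forall s, t0 <= s <= t1 -> [/\ M (y s j).1.1, (y s j).1.2 = label q &
      Jt q (y s j).1.1 - minQ (Jt ^~ (y s j).1.1) <= delta],
    {within `[t0, t1], continuous (fun s => (y s j).1.1)},
    {within `[t0, t1], continuous (fun s => (y s j).2.2)} &
    forall s, t0 < s < t1 ->
      along_flow M b om kappa (Jt q) eps s (fun s => (y s j).1.1) (fun s => (y s j).2.2)].
Proof.
move=> [_ _ flow _] t01 domI.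
have t01' := ltW t01.
have [|ac Cy dy] := flow j.
  exists ((t0 + t1) / 2); apply: (@filterS _ _ _ `]t0, t1[%classic).
    by move=> s; rewrite /= in_itv/= => /andP[t0s st1]; apply: domI; rewrite !ltW.
  apply: open_nbhs_nbhs; split; first exact: interval_open.
  by rewrite /= in_itv/=; apply/andP; split; lra.
have acy : abs_continuous t0 t1 (y ^~ j).
  by apply: ac => // s; rewrite /= in_itv/=; exact: domI.
have Cs s : t0 <= s <= t1 -> es_C M delta Jt (y s j).1.
  by move=> /domI/Cy[].
have c11 : linear_contraction (fun p : 'rV[R]_n * R * (R * R) => p.1.1).
  exact: linear_contraction_comp linear_contraction_fst linear_contraction_fst.
have c12 : linear_contraction (fun p : 'rV[R]_n * R * (R * R) => p.1.2).
  exact: linear_contraction_comp linear_contraction_fst linear_contraction_snd.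
have c22 : linear_contraction (fun p : 'rV[R]_n * R * (R * R) => p.2.2).
  exact: linear_contraction_comp linear_contraction_snd linear_contraction_snd.
have acx := abs_continuous_contraction _ _ _ _ c11 acy.
have acz := abs_continuous_contraction _ _ _ _ c12 acy.
have acth := abs_continuous_contraction _ _ _ _ c22 acy.
have [q zt0 _] := (Cs t0 (introT andP (conj (lexx _) t01'))).2.
(* The logic coordinate has zero derivative almost everywhere; the mean value inequality with slope
   and tolerance 0 makes it constant. *)
have zE s : t0 <= s <= t1 -> (y s j).1.2 = label q.
  move=> /andP[t0s st1].
  have : `|(y s j).1.2 - (y t0 j).1.2 - (s - t0) *: 0| <= 0 * (s - t0).
    apply: (ac_mean_value (fun s => (y s j).1.2)) => //; first exact: sub_abs_continuous acz.
    apply: (negligibleS _ dy); apply: subsetC => u du /andP[t0u us].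
    have [|v [q' _ ->] yv] := du; first by apply: domI; rewrite t0u (le_trans us).
    exists 0; last by rewrite subrr normr0.
    exact: (is_derive_contraction _ _ _ _ c12 yv).
  by rewrite mul0r normr_le0 scaler0 subr0 subr_eq0 zt0 => /eqP.
have Ms s : t0 <= s <= t1 -> M (y s j).1.1 by move=> /Cs[].
have MsI s : `[t0, t1]%classic s -> M (y s j).1.1 by rewrite /= in_itv/=; exact: Ms.
have cx := abs_continuous_continuous _ _ _ acx.
have cth := abs_continuous_continuous _ _ _ acth.
have der u (du : dom (u, j) -> exists2 v, flow_map (sys eps) (y u j) v &
      is_derive (u : R) (1 : R) (y ^~ j) v) :
    t0 <= u <= t1 -> is_derive (u : R) (1 : R) (y ^~ j)
      ((es_flow_x b w kappa Jt eps q (y u j).1.1 (y u j).2.2, 0), (eps^-1, eps ^- 2)).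
  move=> ut; have [v [q' zq' ->]] := du (domI _ ut).
  by move: zq'; rewrite zE// => /label_inj ->.
exists q; split => //.
- move=> s st; split; [exact: Ms|exact: zE|].
  by have [q'] := (Cs s st).2; rewrite zE// => /label_inj ->.
- move=> s /[dup] sI /andP[t0s st1]; split.
  + apply: (@filterS _ _ _ `]t0, t1[%classic).
      by move=> u; rewrite /= in_itv/= => /andP[t0u ut1]; apply: Ms; rewrite !ltW.
    by apply: open_nbhs_nbhs; split; [exact: interval_open|rewrite /= in_itv/=].
  + have -> : \sum_(i < r) (eps^-1 * (Num.sqrt (2 * om i) * (Num.sqrt kappa)^-1 *
          cos (kappa * Jt q (y s j).1.1 + om i * (y s j).2.2))) *: b i (y s j).1.1 =
        es_flow_x b w kappa Jt eps q (y s j).1.1 (y s j).2.2.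
      by apply: eq_bigr => i _; congr (_ *: _); rewrite /om; ring.
    (* The right-hand side is continuous along the solution, which removes the exceptional null
       set. *)
    apply: (ac_derive_continuous (fun s => (y s j).1.1)
      (fun s => es_flow_x b w kappa Jt eps q (y s j).1.1 (y s j).2.2) t0 t1) => //.
    * move=> u; apply: cvg_big => [|i _]; first exact: add_continuous.
      apply: cvgZ; last first.
        have cb : {within M, continuous (b i)}.
          by apply: locally_smooth_continuous; exact: (hb i).2.
        exact: (within_continuous_sub_comp _ _ _ _ MsI cx cb).
      have rc := regularM _ _ _
        (regularM _ _ _ (regular_cst M (eps^-1 * Num.sqrt (2 * om i)))
          (regular_cos M (Jt q) Mcompact (smooth_Jt q) kappa (om i)))
        (regular_cst M (Num.sqrt kappa)^-1).
      exact: (rc.2 _ _ _ cx cth MsI u).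
    * apply: (negligibleS _ dy); apply: subsetC => u du ut.
      exact: (is_derive_contraction _ _ _ _ c11 (der u du ut)).
  + apply: (ac_derive_continuous (fun s => (y s j).2.2) (fun=> eps ^- 2) t0 t1) => //.
      by move=> u; exact: cst_continuous.
    apply: (negligibleS _ dy); apply: subsetC => u du ut.
    exact: (is_derive_contraction _ _ _ _ c22 (der u du ut)).
Qed.

Lemma practical_decrease (rho : R) : 0 < rho ->
  exists a eps0 : R, [/\ 0 < a, 0 < eps0 &
    forall eps, 0 < eps -> eps <= eps0 ->
    forall dom y, hds_solution (sys eps) dom y -> forall t j, dom (t, j) ->
    exists q0 q, [/\ M (y 0 0%N).1.1 /\ (y 0 0%N).1.2 = label q0,
      M (y t j).1.1 /\ (y t j).1.2 = label q &
      Jt q (y t j).1.1 - J xs <=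
        Num.max 0 (Jt q0 (y 0 0%N).1.1 - J xs - a * (t + j%:R)) + rho]].
Proof.
move=> rho_gt0.
have /choice[K0 /choice[P0 HP0]] q := perturbed_lyapunov M b om kappa (Jt q) Mcompact hb
  kappa_gt0 om_gt0 om_inj (smooth_Jt q).
have [K K_ge0 HK] : exists2 K, 0 <= K & forall q, K0 q <= K.
  apply: (finite_choice_monotone _ (fun q x => K0 q <= x)).
    by move=> q x y xy /le_trans; apply.
  by move=> q; exists (K0 q).
have rho4 : 0 < rho / 4 by lra.
have [c c_gt0 Hc] : exists2 c, 0 < c & forall q x, M x -> Jt q x - minQ (Jt ^~ x) <= delta ->
    rho / 4 <= Jt q x - J xs -> c <= dissipation q x.
  apply: (finite_choice_antitone _ (fun q c => forall x, M x -> Jt q x - minQ (Jt ^~ x) <= delta ->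
    rho / 4 <= Jt q x - J xs -> c <= dissipation q x)).
    by move=> q x y xy H z Mz Cz Jz; exact: le_trans (H z Mz Cz Jz).
  by move=> q; exact: dissipation_lower_bound.
have delta0 := delta_gt0.
(* The three bounds on [eps * K] keep the perturbed functions within [rho / 4] of [Jt], preserve
   half of the dissipation [c], and limit the cost of exchanging them at a jump to
   [2 * (delta / 4)]. *)
pose m := Num.min (rho / 4) (Num.min (c / 2) (delta / 4)).
have m_gt0 : 0 < m by rewrite !lt_min rho4/=; apply/andP; split; lra.
have K1_gt0 : 0 < K + 1 by lra.
pose eps0 := Num.min 1 (m / (K + 1)).
(* One rate has to serve both flowing and jumping, since time is measured by [t + j]. *)
pose a := Num.min (c / 2) (delta / 2).
have a_gt0 : 0 < a by rewrite lt_min; apply/andP; split; lra.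
have ac : a <= c / 2 by rewrite ge_min lexx.
have ad : a <= delta / 2 by rewrite ge_min lexx orbT.
exists a, eps0; split => //; first by rewrite lt_min ltr01 divr_gt0.
move=> eps eps_gt0; rewrite le_min => /andP[eps_le1 epsm] dom y sol.
have epsK : eps * K <= m.
  move: epsm; rewrite ler_pdivlMr// => /(le_trans _); apply.
  by rewrite ler_pM2l// lerDl.
have epsKrho : eps * K <= rho / 4 by rewrite (le_trans epsK)// ge_min lexx.
have epsKc : eps * K <= c / 2 by rewrite (le_trans epsK)// !ge_min lexx !orbT.
have epsKd : eps * K <= delta / 4 by rewrite (le_trans epsK)// !ge_min lexx !orbT.
have PJ q x th : M x -> `|P0 q eps x th - Jt q x| <= eps * K.
  move=> Mx; have [_ /(_ _ eps_gt0 eps_le1)[H _ _]] := HP0 q.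
  by rewrite (le_trans (H x th Mx))// ler_pM2l.
have PJle q x th : M x -> P0 q eps x th <= Jt q x + eps * K.
  by move=> Mx; have := PJ q x th Mx; rewrite ler_norml; lra.
have PJge q x th : M x -> Jt q x <= P0 q eps x th + eps * K.
  by move=> Mx; have := PJ q x th Mx; rewrite ler_norml; lra.
have [htd [dom0 start] _ jump] := sol.
have [q0 [M0 z0]] : exists q : 'I_N.+1, M (y 0 0%N).1.1 /\ (y 0 0%N).1.2 = label q.
  by case: start => [[[My [q zq _]] _]|[[My [q zq _]] _]]; exists q.
pose W0 := P0 q0 eps (y 0 0%N).1.1 (y 0 0%N).2.2.
(* The level [rho / 2] is twice the approximation error allowed: above it [Jt q] exceeds [J xs] by
   at least [rho / 4], where the dissipation bound applies. *)
pose G t j := exists q, [/\ M (y t j).1.1, (y t j).1.2 = label q &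
  P0 q eps (y t j).1.1 (y t j).2.2 <=
    Num.max (J xs + rho / 2) (W0 - a * (t + j%:R))].
suff HG t j : dom (t, j) -> G t j.
  move=> t j /HG[q [Mx zq Pq]]; exists q0, q; split => //.
  have := PJge q _ (y t j).2.2 Mx; have := PJle q0 _ (y 0 0%N).2.2 M0.
  rewrite -/W0 => W0J JP.
  move: Pq; rewrite le_max => /orP[Pq|Pq].
    have : 0 <= Num.max 0 (Jt q0 (y 0 0%N).1.1 - J xs - a * (t + j%:R)) by rewrite le_max lexx.
    lra.
  have : Jt q0 (y 0 0%N).1.1 - J xs - a * (t + j%:R) <=
    Num.max 0 (Jt q0 (y 0 0%N).1.1 - J xs - a * (t + j%:R)) by rewrite le_max lexx orbT.
  lra.
apply: hybrid_induction => //.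
- by exists q0; split => //; rewrite le_max addr0 mulr0 subr0 lexx orbT.
- move=> k t0 t1 t01 domI Gt0.
  have [<-//|t01ne] := eqVneq t0 t1.
  have t01lt : t0 < t1 by rewrite lt_neqAle t01ne.
  have [q [inC cx cth fl]] := sys_flow_interval _ _ _ _ _ _ sol t01lt domI.
  have [M1 z1 _] := inC t1 (introT andP (conj t01 (lexx _))).
  exists q; split => //.
  have [_ zq _] := inC t0 (introT andP (conj (lexx _) t01)).
  have [q' [_ + Pt0]] := Gt0; rewrite zq => /label_inj qq'; rewrite -{q'}qq' in Pt0.
  have [_ /(_ _ eps_gt0 eps_le1)[_ [_ regP] dP]] := HP0 q.
  apply: (@le_trans _ _ (Num.max (J xs + rho / 2)
      (P0 q eps (y t0 k).1.1 (y t0 k).2.2 - a * (t1 - t0)))).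
    apply: (decrease_above_level (fun s => P0 q eps (y s k).1.1 (y s k).2.2)) => //.
    - exact: ltW.
    - by apply: regP => // s; rewrite /= in_itv/= => /inC[].
    - move=> s sI; have [d Pd dle] := dP s _ _ (fl s sI).
      exists d => // Ps; apply: (le_trans dle).
      have sI' : t0 <= s <= t1 by move: sI => /andP[? ?]; rewrite !ltW.
      have [Ms _ Cs] := inC s sI'.
      have := PJle q _ (y s k).2.2 Ms.
      have : eps * K0 q <= eps * K by rewrite ler_pM2l.
      move=> e1 e2; have := Hc q _ Ms Cs; rewrite /dissipation => Hd.
      have /Hd : rho / 4 <= Jt q (y s k).1.1 - J xs by lra.
      move=> /= ?; lra.
  rewrite ge_max le_max lexx/= le_max.
  move: Pt0; rewrite le_max => /orP[Pt0|Pt0]; apply/orP; [left|right].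
    have : 0 <= a * (t1 - t0) by rewrite mulr_ge0 ?subr_ge0// ltW.
    lra.
  lra.
- move=> s k domk domk1 [q [Mx zq Pq]].
  have [[Dx _] [q' Jq' yE]] := jump _ _ domk domk1.
  rewrite /G yE; exists q'; split => //=.
  have [_ [q'' + Dq]] := Dx; rewrite zq => /label_inj E; rewrite -{q''}E in Dq.
  have := PJle q' _ (y s k).2.2 Mx; have := PJge q _ (y s k).2.2 Mx.
  move=> e1 e2; rewrite le_max.
  move: Pq; rewrite le_max => /orP[Pq|Pq]; apply/orP; [left|right].
    lra.
  rewrite -natr1; lra.
Qed.

(** Valid for every [eps], as the a priori bound in [KL_bound] requires, whereas
    [practical_decrease] concerns small [eps] only. *)
Lemma sys_solution_range eps dom y t j : hds_solution (sys eps) dom y -> dom (t, j) ->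
  exists q : 'I_N.+1, M (y t j).1.1 /\ (y t j).1.2 = label q.
Proof.
move=> sol; have [htd [_ start] _ jump] := sol.
pose G t j := exists q : 'I_N.+1, M (y t j).1.1 /\ (y t j).1.2 = label q.
apply: (hybrid_induction _ G) => //.
- by case: start => [[[My [q zq _]] _]|[[My [q zq _]] _]]; exists q.
- move=> k t0 t1 t01 domI Gt0; have [<-//|t01ne] := eqVneq t0 t1.
  have t01lt : t0 < t1 by rewrite lt_neqAle t01ne.
  have [q [inC _ _ _]] := sys_flow_interval _ _ _ _ _ _ sol t01lt domI.
  by have [M1 z1 _] := inC t1 (introT andP (conj t01 (lexx _))); exists q.
- move=> s k domk domk1 [q [Mx _]]; have [_ [q' _ yE]] := jump _ _ domk domk1.
  by rewrite /G yE; exists q'.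
Qed.

Lemma es_gpas : GPAS (es_system M b w kappa delta Jt) (es_attractor N xs).
Proof.
pose E (x : 'rV[R]_n) := enorm (x - xs).
have E_ge0 x : 0 <= E x by exact: sqrtr_ge0.
have cE : {within M, continuous E} by apply: continuous_subspaceT; exact: continuous_enormB.
have cV q : {within M, continuous (fun x => Jt q x - J xs)}.
  move=> x; apply: cvgB; last exact: cvg_cst.
  exact: (locally_smooth_continuous _ _ (smooth_Jt q) x).
pose S eps d0 s d := exists dom y t j, [/\ hds_solution (sys eps) dom y, dom (t, j) &
  [/\ d0 = E (y 0 0%N).1.1, s = t + j%:R & d = E (y t j).1.1]].
have [D0 HD0] := compact_within_bounded _ _ Mcompact cE.
have HD x : M x -> E x <= D0 by move=> Mx; rewrite -(ger0_norm (E_ge0 x)) HD0.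
have D_ge0 : 0 <= D0 by rewrite (le_trans (E_ge0 xs)) ?HD.
have SD eps d0 s d : S eps d0 s d -> [/\ 0 <= d0, 0 <= s & d <= D0].
  move=> [dom [y [t [j [sol domtj [-> -> ->]]]]]]; split => //.
    by rewrite addr_ge0//; case: sol => -[/(_ _ domtj)].
  by have [q [Mx _]] := sys_solution_range _ _ _ _ _ sol domtj; exact: HD.
have Sconv nu : 0 < nu -> exists eta T eps0 : R, [/\ 0 < eta, 0 < eps0 &
    forall eps d0 s d, 0 < eps -> eps <= eps0 -> S eps d0 s d ->
      d0 <= eta \/ T <= s -> d <= nu].
  move=> nu0.
  have [rho rho0 Hrho] : exists2 rho, 0 < rho &
      forall q x, M x -> Jt q x - J xs < rho -> E x < nu.
    apply: (finite_choice_antitone _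
      (fun q rho => forall x, M x -> Jt q x - J xs < rho -> E x < nu)).
      by move=> q x y xy H z Mz Jz; apply: H => //; exact: lt_le_trans xy.
    move=> q; apply: compact_dominance Mcompact (cV q) cE _ _ nu0 => x Mx.
    rewrite subr_le0 => /(Jt_le_eq _ _ Mx) ->.
    by rewrite /E subrr /enorm /dotv big1 ?sqrtr0// => i _; rewrite mxE mul0r.
  have rho2 : 0 < rho / 2 by lra.
  have [eta eta0 Heta] : exists2 eta, 0 < eta &
      forall q x, M x -> E x < eta -> Jt q x - J xs < rho / 2.
    apply: (finite_choice_antitone _
      (fun q eta => forall x, M x -> E x < eta -> Jt q x - J xs < rho / 2)).
      by move=> q x y xy H z Mz Ez; apply: H => //; exact: lt_le_trans xy.
    move=> q; apply: compact_dominance Mcompact cE (cV q) _ _ rho2 => x Mx Ex.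
    suff -> : x = xs by rewrite Jt_xs subrr.
    apply/eqP; rewrite -subr_eq0; apply/eqP/dotv_eq0/le_anti.
    by rewrite dotv_ge0 andbT -sqrtr_eq0; apply/eqP/le_anti; rewrite Ex E_ge0.
  have [B _ HB] : exists2 B, 0 <= B & forall q x, M x -> Jt q x - J xs <= B.
    apply: (finite_choice_monotone _ (fun q B => forall x, M x -> Jt q x - J xs <= B)).
      by move=> q x y xy H z Mz; rewrite (le_trans (H z Mz)).
    move=> q; have [B HB] := compact_within_bounded _ _ Mcompact (cV q).
    by exists B => x Mx; rewrite (le_trans (ler_norm _))// HB.
  have [a [eps0 [a0 eps0_gt0 H]]] := practical_decrease _ rho2.
  (* Half of [eta] turns the closed condition on the initial distance into a strict one. After
     hybrid time [B / a] the guaranteed decrease has used up the largest possible initial value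
     [B]. *)
  exists (eta / 2), (B / a), eps0; split => //; first by lra.
  move=> eps d0 s d eps_gt0 eps_le [dom [y [t [j [sol domtj [-> -> ->]]]]]] rs.
  have [q0 [q [[M0 _] [Mx _] Vle]]] := H _ eps_gt0 eps_le _ _ sol _ _ domtj.
  apply/ltW/(Hrho q) => //; apply: le_lt_trans Vle _.
  suff : Num.max 0 (Jt q0 (y 0 0%N).1.1 - J xs - a * (t + j%:R)) < rho / 2 by lra.
  rewrite gt_max rho2/=; case: rs => [Er|Ts].
    have : Jt q0 (y 0 0%N).1.1 - J xs < rho / 2 by apply: Heta => //; lra.
    have : 0 <= a * (t + j%:R).
      by rewrite mulr_ge0 ?(ltW a0)// addr_ge0//; case: sol => -[/(_ _ domtj)].
    lra.
  have := HB q0 _ M0; move: Ts; rewrite ler_pdivrMr// mulrC; lra.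
have [beta KLbeta Hbeta] := KL_bound S D0 D_ge0 SD Sconv.
exists beta => // nu nu0; have [eps0 eps0_gt0 H] := Hbeta _ nu0.
exists eps0 => // eps eps_gt0 eps_le dom y sol t j domtj.
have [_ [dom0 _] _ _] := sol.
have [q0 [_ z0]] := sys_solution_range _ _ _ _ _ sol dom0.
have [q [_ zq]] := sys_solution_range _ _ _ _ _ sol domtj.
rewrite [(y t j).1]surjective_pairing zq [(y 0 0%N).1]surjective_pairing z0 !dist_es_attractor.
by apply: (H eps) => //; exists dom, y, t, j.
Qed.

End ExtremumSeekingStability.

Theorem proposition3 (R : realType) (n r N : nat)
  (M U : set 'rV[R]_n) (J : 'rV[R]_n -> R) (xs : 'rV[R]_n) (Jbar : R)
  (b : 'I_r -> 'rV[R]_n -> 'rV[R]_n) (w : 'I_r -> rat)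
  (Jt : 'I_N.+1 -> 'rV[R]_n -> R) (delta kappa : R)
  (hkappa : 0 < kappa)
  (hw_pos : forall i, 0 < w i)
  (hw_inj : forall i j, i <> j -> w i <> w j)
  (hM : embedded_submanifold M) (hMconn : connected M) (hMcomp : compact M)
  (hU : open U) (hMU : M `<=` U) (hJ : smooth_on U J)
  (hxs : unique_minimizer M J xs)
  (hJbar : 0 < Jbar)
  (hJcrit : forall x, M x -> J x < J xs + Jbar ->
     (riem_gradient M J x = 0 <-> x = xs))
  (hb : forall i, smooth_vector_field M (b i))
  (hP : forall x v, M x ->
     (\sum_(i < r) dotv (b i x) v *: b i x = 0 <->
      forall u, tangent_space M x u -> dotv v u = 0))
  (hsyn : synergistic_family M U J xs Jbar delta Jt) :
  GPAS (es_system M b w kappa delta Jt) (es_attractor N xs).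
Proof.
exact: (es_gpas M U J xs Jbar b w Jt delta kappa hkappa hw_pos hw_inj hMcomp hU hMU hJbar
  hxs.1 hb hP hsyn).
Qed.
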